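(* For any operad $\mathcal{O}$ in $\mathbf{Op}$ there are natural isomorphisms of operads $$\operatorname{Ass}_\bullet(\mathcal{O})=\mathcal{A}ss\bullet\mathcal{O},\qquad \operatorname{Com}_\bullet(\mathcal{O})=\mathcal{C}om\bullet\mathcal{O},\qquad \operatorname{preLie}_\bullet(\mathcal{O})=pre\mathcal{L}ie\bullet\mathcal{O},$$ where $\bullet$ on the right-hand sides denotes the Manin black product of operads.
   Context: Operads. $\mathbf{Op}$ is the category of finitely generated binary quadratic symmetric operads in vector spaces over a field $\mathbb{K}$. An operad in $\mathbf{Op}$ is written $(\mathcal{O},\cdot_i,\bullet_j,[-,-]_k)$: it is generated by non-symmetric operations $\cdot_i$ ($1\le i\le p$), symmetric operations $\bullet_j$ ($1\le j\le q$) and anti-symmetric operations $[-,-]_k$ ($1\le k\le r$), subject to quadratic (ternary) relations, omitted from the notation. Operads are thought of through their type of algebras. $\mathcal{A}ss$, $\mathcal{C}om$, $pre\mathcal{L}ie$ are the operads of associative, of commutative associative, and of right pre-Lie algebras (one product whose associator $(xy)z-x(yz)$ is symmetric in $y,z$). Manin products. For $\mathcal{O},\mathcal{P}\in\mathbf{Op}$ the white product $\mathcal{O}\circ\mathcal{P}\in\mathbf{Op}$ is generated by $\mathcal{O}(2)\otimes\mathcal{P}(2)$ (diagonal $S_2$-action) with all ternary quadratic relations that hold in $\mathcal{O}(3)\otimes\mathcal{P}(3)$, i.e. that hold for the tensor product operations on $A\otimes V$ for all $\mathcal{O}$-algebras $A$ and $\mathcal{P}$-algebras $V$. The black product is $\mathcal{O}\bullet\mathcal{P}=(\mathcal{O}^!\circ\mathcal{P}^!)^!$,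 where $(-)^!$ is Koszul duality of binary quadratic operads. Cochains. For a vector space $V$, $C^*(\Delta_1;V)$ is the complex of non-degenerate cochains on the $1$-simplex $\Delta_1$ with coefficients in $V$. Its degree $0$ part consists of the elements $\lambda(x)+\rho(y)$, $x,y\in V$, where $\lambda(x)$ (resp. $\rho(x)$) is the $0$-cochain with value $x$ on the left vertex $v_l$ (resp. the right vertex $v_r$) and $0$ on the other vertex; its degree $1$ part consists of the $1$-cochains $\sigma(x)$, $x\in V$, with value $x$ on the $1$-cell. The differential is $d\lambda(x)=-\sigma(x)$, $d\rho(x)=\sigma(x)$. For closed $X\subset\Delta_1$ ($X=v_l$, $v_r$ or $\partial\Delta_1=v_l\sqcup v_r$), $C^*(\Delta_1,X;V)$ is the subcomplex of cochains vanishing on $X$. $\operatorname{Ass}_\bullet$. An $\operatorname{Ass}_\bullet(\mathcal{O})$-algebra structure on $V$ is the datum of (degree $0$) operations $\cdot_i',\bullet_j',[-,-]_k'$ on $C^*(\Delta_1;V)$ making $(C^*(\Delta_1;V),d,\cdot'_i,\bullet'_j,[-,-]'_k)$ a dg $\mathcal{O}$-algebra which is local, i.e. for all $X=v_l,v_r,\partial\Delta_1$ the subcomplex $C^*(\Delta_1,X;V)$ is a dg $\mathcal{O}$-ideal. Such a structure is equivalent to operations $\prec_i,\succ_i,\circ_j,\ast_k:V^{\otimes2}\to V$ satisfying certain quadratic relations, via $$\lambda(x)\cdot_i'\sigma(y)=\sigma(x\prec_i y)=\sigma(x)\cdot_i'\rho(y),\qquad \rho(x)\cdot_i'\sigma(y)=-\sigma(y\succ_i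 x)=\sigma(x)\cdot_i'\lambda(y),$$ $$\lambda(x)\bullet_j'\sigma(y)=\sigma(x)\bullet_j'\rho(y)=\sigma(x\circ_j y),\qquad [\lambda(x),\sigma(y)]_k'=[\sigma(x),\rho(y)]_k'=\sigma(x\ast_k y),$$ so it defines an operad $\operatorname{Ass}_\bullet(\mathcal{O})\in\mathbf{Op}$ generated by the non-symmetric operations $\prec_i,\succ_i,\circ_j,\ast_k$, functorially in $\mathcal{O}$ (a morphism $\mathcal{O}\to\mathcal{P}$ lets one regard local dg $\mathcal{P}$-algebra structures as local dg $\mathcal{O}$-algebra structures). The associated $\mathcal{O}$-algebra structure on $V$ is $x\cdot_i y=x\prec_i y-y\succ_i x$, $x\bullet_j y=x\circ_j y+y\circ_j x$, $[x,y]_k=x\ast_k y-y\ast_k x$. $\operatorname{Com}_\bullet$. A $\operatorname{Com}_\bullet(\mathcal{O})$-algebra is an $\operatorname{Ass}_\bullet(\mathcal{O})$-algebra whose associated $\mathcal{O}$-algebra is trivial. That is, $\operatorname{Com}_\bullet(\mathcal{O})$ is generated by non-symmetric products $\star_i$, anti-commutative brackets $\{-,-\}_j$ and commutative products $\circledast_k$, with the relations obtained from those of $\operatorname{Ass}_\bullet(\mathcal{O})$ by imposing $x\prec_i y=y\succ_i x=:x\star_i y$, $x\circ_j y=-y\circ_j x=:\{x,y\}_j$, $x\ast_k y=y\ast_k x=:x\circledast_k y$. $\operatorname{preLie}_\bullet$. A $\operatorname{preLie}_\bullet(\mathcal{O})$-algebra structure on $V$ is a dg $\mathcal{O}$-algebra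 structure on the complex $C^*(\Delta_1,v_l;V)$ (elements $\rho(x)$ in degree $0$ and $\sigma(x)$ in degree $1$). As before this is encoded by operations $\prec_i,\succ_i,\circ_j,\ast_k$ on $V$, via $\sigma(x)\cdot_i'\rho(y)=\sigma(x\prec_i y)$, $\rho(x)\cdot_i'\sigma(y)=-\sigma(y\succ_i x)$, $\sigma(x)\bullet_j'\rho(y)=\sigma(x\circ_j y)$, $[\sigma(x),\rho(y)]_k'=\sigma(x\ast_k y)$, and defines an operad $\operatorname{preLie}_\bullet(\mathcal{O})\in\mathbf{Op}$, functorially in $\mathcal{O}$. *)

(* Defs.v *)
From HB Require Import structures.
From mathcomp Require Import all_boot all_order all_algebra all_fingroup.
Set Implicit Arguments.
Unset Strict Implicit.
Unset Printing Implicit Defensive.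
Import GRing.Theory.
Local Open Scope ring_scope.

(* A binary quadratic operad is determined by the S_2-module O(2) and by the
   kernel of F(O(2))(3) -> O(3), where F is the free operad; an operad morphism
   O -> P is determined by its arity 2 component O(2) -> P(2), which can be any
   S_2-equivariant map sending the relations of O to relations of P.  The
   category Op is presented below in these terms. *)

(* The S_2-module O(2), with a basis which the transposition permutes up to
   sign: (e_i)^(12) = (-1)^(gneg i) e_(gswap i), i.e. for operations
   e_i(y, x) = (-1)^(gneg i) e_(gswap i)(x, y).  Every finite dimensional
   S_2-module has such a basis, in any characteristic.  Non-symmetric operations
   contribute two basis elements: the operation and its opposite. *)
Record gens := Gens {
  gidx :> finType;
  gswap : gidx -> gidx;
  gneg : gidx -> bool;
  gswapK : involutive gswap;
  gneg_swap : forall i, gneg (gswap i) = gneg i }.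

(* Coefficients of an element of F(O(2))(3) in the basis
   (c, i, j) |-> e_i(e_j(x_c, x_(c+1)), x_(c+2)), variables indexed by Z/3. *)
Notation ternary K G := {ffun 'Z_3 * gidx G * gidx G -> K^o}.

Section Ternary.
Variables (K : fieldType) (G : gens).
Implicit Types (i j : G) (a b c : 'Z_3).

(* e_i(e_j(x_a, x_b), x_c), for a, b, c the three distinct variables *)
Definition lmon a b c i j : ternary K G :=
  [ffun t => if b == a + 1 then (t == (a, i, j))%:R
             else (-1) ^+ gneg j * (t == (b, i, gswap j))%:R].

(* e_i(x_a, e_j(x_b, x_c)) *)
Definition rmon a b c i j : ternary K G :=
  (-1) ^+ gneg i *: lmon b c a (gswap i) j.

Definition tact (s : {perm 'Z_3}) (r : ternary K G) : ternary K G :=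
  \sum_c \sum_i \sum_j
    r (c, i, j) *: lmon (s c) (s (c + 1)) (s (c + 2)) i j.

(* the S_3-submodule generated by S *)
Definition tspan (S : ternary K G -> Prop) (r : ternary K G) : Prop :=
  forall W : ternary K G -> Prop,
    W 0 ->
    (forall (k : K) u v, W u -> W v -> W (k *: u + v)) ->
    (forall s u, W u -> W (tact s u)) ->
    (forall u, S u -> W u) ->
    W r.

End Ternary.

Record operad (K : fieldType) := Operad {
  ogen : gens;
  orel : ternary K ogen -> Prop }.

(* all the ternary relations of O, i.e. the kernel of F(O(2))(3) -> O(3) *)
Definition orelations (K : fieldType) (O : operad K) : ternary K (ogen O) -> Prop :=
  tspan (@orel K O).

(* Matrix of a linear map O(2) -> P(2): e_i |-> \sum_j f (i, j) e_j *)
Notation hom2 K G H := {ffun gidx G * gidx H -> K}.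

Section Morphisms.
Variable K : fieldType.

Definition equivariant2 (G H : gens) (f : hom2 K G H) : Prop :=
  forall i j, f (gswap i, gswap j) = (-1) ^+ (gneg i (+) gneg j) * f (i, j).

Definition hom3 (G H : gens) (f : hom2 K G H) (r : ternary K G) : ternary K H :=
  [ffun t => \sum_i \sum_j
     r (t.1.1, i, j) * f (i, t.1.2) * f (j, t.2)].

Definition is_mor (O P : operad K) (f : hom2 K (ogen O) (ogen P)) : Prop :=
  equivariant2 f /\ forall r, orelations r -> @orelations K P (hom3 f r).

Definition hom2_id (G : gens) : hom2 K G G := [ffun t => (t.1 == t.2)%:R].

(* first f, then g *)
Definition hom2_comp (G H L : gens) (f : hom2 K G H) (g : hom2 K H L) :
    hom2 K G L :=
  [ffun t => \sum_j f (t.1, j) * g (j, t.2)].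

Definition is_iso (O P : operad K) (f : hom2 K (ogen O) (ogen P)) : Prop :=
  is_mor f /\
  exists g : hom2 K (ogen P) (ogen O),
    [/\ is_mor g, hom2_comp f g = hom2_id (ogen O)
      & hom2_comp g f = hom2_id (ogen P)].

End Morphisms.

(* Koszul dual: O^!(2) = O(2)^* (x) sgn, with the dual basis, and relations
   the orthogonal of those of O.  The pairing is the one identifying
   F(O^!(2))(3) with F(O(2))(3)^* (x) sgn; the bases indexed by (c, i, j) are
   dual to each other for it, because c, c+1, c+2 is an even permutation of the
   variables. *)
Section KoszulDual.
Variable K : fieldType.

Definition gens_dual (G : gens) : gens :=
  @Gens G (@gswap G) (fun i => ~~ gneg i) (@gswapK G)
    (fun i => congr1 negb (gneg_swap i)).

Definition koszul_dual (O : operad K) : operad K :=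
  @Operad K (gens_dual (ogen O))
    (fun phi => forall r : ternary K (ogen O), orelations r ->
       \sum_c \sum_i \sum_j phi (c, i, j) * r (c, i, j) = 0).

Definition koszul_dual_mor (G H : gens) (f : hom2 K G H) :
    hom2 K (gens_dual H) (gens_dual G) :=
  [ffun t => f (t.2, t.1)].

End KoszulDual.

Section ManinProducts.
Variable K : fieldType.

Definition tens_swap (G H : gens) (t : G * H) : G * H := (gswap t.1, gswap t.2).
Definition tens_neg (G H : gens) (t : G * H) : bool := gneg t.1 (+) gneg t.2.

Lemma tens_swapK (G H : gens) : involutive (@tens_swap G H).
Proof. by case=> i j; rewrite /tens_swap /= !gswapK. Qed.

Lemma tens_neg_swap (G H : gens) (t : G * H) :
  tens_neg (tens_swap t) = tens_neg t.
Proof. by rewrite /tens_neg /= !gneg_swap. Qed.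

Definition gens_tens (G H : gens) : gens :=
  Gens (@tens_swapK G H) (@tens_neg_swap G H).

(* F(O(2) (x) P(2))(3) -> F(O(2))(3) (x) F(P(2))(3) *)
Definition tens3 (G H : gens) (w : ternary K (gens_tens G H)) :
    {ffun ('Z_3 * G * G) * ('Z_3 * H * H) -> K^o} :=
  [ffun t => let: ((c, i, j), (c', i', j')) := t in
     (c == c')%:R * w (c, (i, i'), (j, j'))].

(* A relation holds in O(3) (x) P(3) = F(O(2))(3)/R (x) F(P(2))(3)/S when
   its image is in R (x) F(P(2))(3) + F(O(2))(3) (x) S. *)
Definition white (O P : operad K) : operad K :=
  @Operad K (gens_tens (ogen O) (ogen P))
    (fun w => exists A B : {ffun _ -> K^o},
       [/\ tens3 w = A + B,
           forall v, orelations [ffun u => A (u, v)]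
         & forall u, orelations [ffun v => B (u, v)]]).

Definition white_mor (G G' H H' : gens) (f : hom2 K G G') (g : hom2 K H H') :
    hom2 K (gens_tens G H) (gens_tens G' H') :=
  [ffun t => f (t.1.1, t.2.1) * g (t.1.2, t.2.2)].

Definition black (O P : operad K) : operad K :=
  koszul_dual (white (koszul_dual O) (koszul_dual P)).

Definition black_mor (G G' H H' : gens) (f : hom2 K G G') (g : hom2 K H H') :=
  koszul_dual_mor (white_mor (koszul_dual_mor f) (koszul_dual_mor g)).

End ManinProducts.

(* Operads written (O, ._i, o_j, [-,-]_k) with p non-symmetric, q symmetric and
   r anti-symmetric operations *)
Section PresentedOperads.
Variable K : fieldType.

Definition pidx (p q r : nat) := ('I_p * bool + 'I_q + 'I_r)%type.

(* nsym i false is the operation, nsym i true its opposite *)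
Definition nsym {p q r} (i : 'I_p) (b : bool) : pidx p q r := inl (inl (i, b)).
Definition symm {p q r} (j : 'I_q) : pidx p q r := inl (inr j).
Definition anti {p q r} (k : 'I_r) : pidx p q r := inr k.

Definition pswap p q r (g : pidx p q r) : pidx p q r :=
  match g with inl (inl (i, b)) => nsym i (~~ b) | _ => g end.
Definition pneg p q r (g : pidx p q r) : bool :=
  match g with inr _ => true | _ => false end.

Lemma pswapK p q r : involutive (@pswap p q r).
Proof. by case=> [[[i b]|j]|k] //=; rewrite negbK. Qed.

Lemma pneg_swap p q r (g : pidx p q r) : pneg (pswap g) = pneg g.
Proof. by case: g => [[[i b]|j]|k]. Qed.

Definition pgens (p q r : nat) : gens := Gens (@pswapK p q r) (@pneg_swap p q r).

Record presented := Presented {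
  nbr_nsym : nat;
  nbr_symm : nat;
  nbr_anti : nat;
  prel : ternary K (pgens nbr_nsym nbr_symm nbr_anti) -> Prop }.

Definition presented_gens (O : presented) : gens :=
  pgens (nbr_nsym O) (nbr_symm O) (nbr_anti O).

Definition presented_operad (O : presented) : operad K :=
  @Operad K (presented_gens O) (@prel O).

End PresentedOperads.

Coercion presented_operad : presented >-> operad.

Section ClassicalOperads.
Variable K : fieldType.

Definition Ass : presented K :=
  let m : pgens 1 0 0 := nsym ord0 false in
  @Presented K 1 0 0 (fun r => r = lmon K 0 1 2 m m - rmon K 0 1 2 m m).

Definition Com : presented K :=
  let m : pgens 0 1 0 := symm ord0 in
  @Presented K 0 1 0 (fun r => r = lmon K 0 1 2 m m - rmon K 0 1 2 m m).

(* right pre-Lie: the associator of x_0, x_1, x_2 is symmetric in x_1, x_2 *)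
Definition preLie : presented K :=
  let m : pgens 1 0 0 := nsym ord0 false in
  @Presented K 1 0 0 (fun r =>
    r = (lmon K 0 1 2 m m - rmon K 0 1 2 m m)
        - (lmon K 0 2 1 m m - rmon K 0 2 1 m m)).

End ClassicalOperads.

Section DgAlgebras.
Variable K : fieldType.

(* cdeg k is the subspace of homogeneous elements of degree k *)
Record complex := Complex {
  ccar :> lmodType K;
  cdeg : nat -> ccar -> Prop;
  cdiff : ccar -> ccar;
  cdiff_linear : linear cdiff;
  cdiff_deg : forall k x, cdeg k x -> cdeg k.+1 (cdiff x);
  cdiffK : forall x, cdiff (cdiff x) = 0 }.

Definition bilinear2 (V : lmodType K) (m : V -> V -> V) : Prop :=
  (forall x, linear (m x)) /\ (forall y, linear (fun x => m x y)).

(* exponent of the Koszul sign of (x_0, x_1, x_2) |-> (x_c, x_(c+1), x_(c+2)) *)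
Definition koszul_exp (d : 'Z_3 -> nat) (c : 'Z_3) : nat :=
  if c == 0 then 0%N
  else if c == 1 then (d 0%R * (d 1%R + d 2%R))%N
  else (d 2%R * (d 0%R + d 1%R))%N.

(* value of r on elements x_0, x_1, x_2 of degrees d_0, d_1, d_2 *)
Definition teval (G : gens) (V : lmodType K) (m : G -> V -> V -> V)
    (d : 'Z_3 -> nat) (x : 'Z_3 -> V) (r : ternary K G) : V :=
  \sum_c \sum_i \sum_j ((-1) ^+ koszul_exp d c * r (c, i, j)) *:
    m i (m j (x c) (x (c + 1))) (x (c + 2)).

Definition is_dg_algebra (O : operad K) (C : complex)
    (m : ogen O -> C -> C -> C) : Prop :=
  [/\ forall i, bilinear2 (m i),
      forall i k l x y, cdeg k x -> cdeg l y -> cdeg (k + l) (m i x y),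
      forall i k x y, cdeg k x ->
        cdiff (m i x y) = m i (cdiff x) y + (-1) ^+ k *: m i x (cdiff y),
      forall i k l x y, cdeg k x -> cdeg l y ->
        m i y x = (-1) ^+ (k * l + gneg i) *: m (gswap i) x y
    & forall r, orelations r ->
        forall d x, (forall a, cdeg (d a) (x a)) -> teval m d x r = 0].

Definition is_dg_ideal (O : operad K) (C : complex)
    (m : ogen O -> C -> C -> C) (W : C -> Prop) : Prop :=
  [/\ W 0, forall a x y, W x -> W y -> W (a *: x + y),
      forall x, W x -> W (cdiff x)
    & forall i x y, W x -> W (m i x y) /\ W (m i y x)].

(* the operations e_i of G, acting on an ungraded vector space *)
Definition is_operations (G : gens) (V : lmodType K) (n : G -> V -> V -> V) :
    Prop :=
  (forall i, bilinear2 (n i)) /\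
  (forall i x y, n i y x = (-1) ^+ gneg i *: n (gswap i) x y).

Definition satisfies (G : gens) (V : lmodType K) (n : G -> V -> V -> V)
    (r : ternary K G) : Prop :=
  forall x : 'Z_3 -> V, teval n (fun=> 0%N) x r = 0.

End DgAlgebras.


(* Cochains on Delta_1: ((x, y), z) stands for lambda(x) + rho(y) + sigma(z). *)
Section Interval.
Variables (K : fieldType) (V : lmodType K).

Definition lambda (x : V) : V * V * V := (x, 0, 0).
Definition rho (x : V) : V * V * V := (0, x, 0).
Definition sigma (x : V) : V * V * V := (0, 0, x).

Definition ideg (k : nat) (u : V * V * V) : Prop :=
  match k with
  | 0 => u.2 = 0
  | 1 => u.1 = 0
  | _ => u = 0
  end.

Definition idiff (u : V * V * V) : V * V * V := (0, 0, u.1.2 - u.1.1).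

Lemma idiff_linear : linear idiff.
Proof.
move=> a u v; rewrite /idiff; congr (_, _, _) => /=; rewrite ?scaler0 ?addr0 //.
by rewrite scalerBr opprD addrACA.
Qed.

Lemma idiff_deg k u : ideg k u -> ideg k.+1 (idiff u).
Proof.
by case: k => [|[|k]] //= u0; rewrite /idiff u0 subrr.
Qed.

Lemma idiffK u : idiff (idiff u) = 0.
Proof. by rewrite /idiff /= subrr. Qed.

Definition interval : complex K := Complex idiff_linear idiff_deg idiffK.

(* cochains vanishing on v_l, on v_r, on both *)
Definition vanish_l (u : V * V * V) : Prop := u.1.1 = 0.
Definition vanish_r (u : V * V * V) : Prop := u.1.2 = 0.
Definition vanish_lr (u : V * V * V) : Prop := vanish_l u /\ vanish_r u.

(* C^*(Delta_1, v_l; V), where (y, z) stands for rho(y) + sigma(z) *)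
Definition rel_rho (x : V) : V * V := (x, 0).
Definition rel_sigma (x : V) : V * V := (0, x).

Definition rel_deg (k : nat) (u : V * V) : Prop :=
  match k with
  | 0 => u.2 = 0
  | 1 => u.1 = 0
  | _ => u = 0
  end.

Definition rel_diff (u : V * V) : V * V := (0, u.1).

Lemma rel_diff_linear : linear rel_diff.
Proof.
by move=> a u v; rewrite /rel_diff; congr (_, _); rewrite /= scaler0 addr0.
Qed.

Lemma rel_diff_deg k u : rel_deg k u -> rel_deg k.+1 (rel_diff u).
Proof. by case: k => [|[|k]] //= u0; rewrite /rel_diff u0. Qed.

Lemma rel_diffK u : rel_diff (rel_diff u) = 0.
Proof. by []. Qed.

Definition rel_interval : complex K :=
  Complex rel_diff_linear rel_diff_deg rel_diffK.

End Interval.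

Arguments interval {K} V.
Arguments rel_interval {K} V.

Section Constructions.
Variable K : fieldType.
Implicit Types O P : presented K.

Definition is_local_dg_algebra O (V : lmodType K)
    (m : ogen O -> interval V -> interval V -> interval V) : Prop :=
  [/\ is_dg_algebra m, is_dg_ideal m (@vanish_l K V),
      is_dg_ideal m (@vanish_r K V) & is_dg_ideal m (@vanish_lr K V)].

(* Generating operations of Ass_bullet O and preLie_bullet O.  In (g, b), g is one of
   prec_i, succ_i, circ_j, ast_k, and (g, true) is its opposite. *)
Definition aidx (p q r : nat) := ('I_p + 'I_p + 'I_q + 'I_r)%type.

Definition free_swap (J : finType) (g : J * bool) : J * bool := (g.1, ~~ g.2).

Lemma free_swapK J : involutive (@free_swap J).
Proof. by case=> g b; rewrite /free_swap /= negbK. Qed.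

Definition free_gens (J : finType) : gens :=
  Gens (@free_swapK J) (fun _ : J * bool => erefl false).

Definition agens p q r : gens := free_gens (aidx p q r).

Definition prec {p q r} (i : 'I_p) : agens p q r := (inl (inl (inl i)), false).
Definition succ {p q r} (i : 'I_p) : agens p q r := (inl (inl (inr i)), false).
Definition circ {p q r} (j : 'I_q) : agens p q r := (inl (inr j), false).
Definition ast {p q r} (k : 'I_r) : agens p q r := (inr k, false).

Definition oagens O : gens := agens (nbr_nsym O) (nbr_symm O) (nbr_anti O).

Definition Ass_encodes O (V : lmodType K)
    (m : presented_gens O -> interval V -> interval V -> interval V)
    (n : oagens O -> V -> V -> V) : Prop :=
  let l := @lambda K V in let r := @rho K V in let s := @sigma K V in
  [/\ forall i x y,
        [/\ m (nsym i false) (l x) (s y) = s (n (prec i) x y),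
            m (nsym i false) (s x) (r y) = s (n (prec i) x y),
            m (nsym i false) (r x) (s y) = - s (n (succ i) y x)
          & m (nsym i false) (s x) (l y) = - s (n (succ i) y x)],
      forall j x y,
        m (symm j) (l x) (s y) = s (n (circ j) x y) /\
        m (symm j) (s x) (r y) = s (n (circ j) x y)
    & forall k x y,
        m (anti k) (l x) (s y) = s (n (ast k) x y) /\
        m (anti k) (s x) (r y) = s (n (ast k) x y)].

(* The relations are those satisfied by the operations on V encoding any
   local dg O-algebra structure on C^*(Delta_1; V), for any V. *)
Definition Ass_bullet O : operad K :=
  @Operad K (oagens O) (fun rel =>
    forall (V : lmodType K)
      (m : presented_gens O -> interval V -> interval V -> interval V)
      (n : oagens O -> V -> V -> V),
      is_local_dg_algebra m -> is_operations n -> Ass_encodes m n ->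
      satisfies n rel).

(* For each generator of Ass_bullet O, the operation e of O (up to the sign aneg)
   such that lambda(x) e sigma(y), which is also sigma(x) e rho(y), is sigma of
   that generator at (x, y).  For succ_i this is minus the opposite of ._i,
   since sigma(y) ._i lambda(x) = - sigma(x succ_i y). *)
Definition aop p q r (g : aidx p q r) : pgens p q r :=
  match g with
  | inl (inl (inl i)) => nsym i false
  | inl (inl (inr i)) => nsym i true
  | inl (inr j) => symm j
  | inr k => anti k
  end.

Definition aneg p q r (g : aidx p q r) : bool :=
  if g is inl (inl (inr _)) then true else false.

(* For f : O -> P, the map expressing the operations on V encoding the local
   dg O-algebra structure pulled back along f in terms of those encoding the
   given local dg P-algebra structure. *)
Definition Ass_bullet_mor O P (f : hom2 K (presented_gens O) (presented_gens P)) :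
    hom2 K (oagens O) (oagens P) :=
  [ffun t => let: ((g, b), (h, b')) := t in
     (b == b')%:R * (-1) ^+ (aneg g (+) aneg h) * f (aop g, aop h)].

(* Generators of Com_bullet O: star_i, the commutative products of index k (one for
   each bracket of O) and the anti-commutative brackets {,}_j. *)
Definition cgens p q r : gens := pgens p r q.

Definition ocgens O : gens := cgens (nbr_nsym O) (nbr_symm O) (nbr_anti O).

(* prec_i |-> star_i, succ_i |-> opposite of star_i, circ_j |-> {,}_j,
   ast_k |-> the k-th commutative product *)
Definition com_proj p q r : hom2 K (agens p q r) (cgens p q r) :=
  [ffun t => let: ((g, b), h) := t in
     match g with
     | inl (inl (inl i)) => (h == nsym i b)%:R
     | inl (inl (inr i)) => (h == nsym i (~~ b))%:R
     | inl (inr j) => (-1) ^+ b * (h == anti j)%:R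
     | inr k => (h == symm k)%:R
     end].

Definition Com_bullet O : operad K :=
  @Operad K (ocgens O) (fun rel =>
    exists2 rel', @orelations K (Ass_bullet O) rel' &
      rel = hom3 (com_proj _ _ _) rel').

(* a preimage of each generator under com_proj *)
Definition com_lift p q r (h : cgens p q r) : agens p q r :=
  match h with
  | inl (inl (i, b)) => (inl (inl (inl i)), b)
  | inl (inr k) => ast k
  | inr j => circ j
  end.

(* the map induced by Ass_bullet_mor f on quotients *)
Definition Com_bullet_mor O P (f : hom2 K (presented_gens O) (presented_gens P)) :
    hom2 K (ocgens O) (ocgens P) :=
  [ffun t => \sum_h Ass_bullet_mor f (com_lift t.1, h) * com_proj _ _ _ (h, t.2)].

Definition preLie_encodes O (V : lmodType K)
    (m : presented_gens O -> rel_interval V -> rel_interval V -> rel_interval V)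
    (n : oagens O -> V -> V -> V) : Prop :=
  let r := @rel_rho K V in let s := @rel_sigma K V in
  [/\ forall i x y,
        m (nsym i false) (s x) (r y) = s (n (prec i) x y) /\
        m (nsym i false) (r x) (s y) = - s (n (succ i) y x),
      forall j x y, m (symm j) (s x) (r y) = s (n (circ j) x y)
    & forall k x y, m (anti k) (s x) (r y) = s (n (ast k) x y)].

Definition preLie_bullet O : operad K :=
  @Operad K (oagens O) (fun rel =>
    forall (V : lmodType K)
      (m : presented_gens O -> rel_interval V -> rel_interval V -> rel_interval V)
      (n : oagens O -> V -> V -> V),
      @is_dg_algebra K O (rel_interval V) m -> is_operations n ->
      preLie_encodes m n -> satisfies n rel).

(* same formula as for Ass_bullet: sigma(x) e rho(y) has the same expression *)
Definition preLie_bullet_mor O P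
    (f : hom2 K (presented_gens O) (presented_gens P)) :
    hom2 K (oagens O) (oagens P) := Ass_bullet_mor f.

Definition black_left (Q : operad K) O : operad K := black Q O.

Definition black_left_mor (Q : operad K) O P
    (f : hom2 K (presented_gens O) (presented_gens P)) :
    hom2 K (ogen (black_left Q O)) (ogen (black_left Q P)) :=
  black_mor (hom2_id K (ogen Q)) f.

Definition hom_map (F : presented K -> operad K) :=
  forall O P, hom2 K (presented_gens O) (presented_gens P) ->
    hom2 K (ogen (F O)) (ogen (F P)).

Definition is_functor (F : presented K -> operad K) (Fmor : hom_map F) : Prop :=
  [/\ forall O P f, @is_mor K O P f -> is_mor (Fmor O P f),
      forall O, Fmor O O (hom2_id K _) = hom2_id K _
    & forall O P (Q : presented K) f g, @is_mor K O P f -> @is_mor K P Q g ->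
        Fmor O Q (hom2_comp f g) = hom2_comp (Fmor O P f) (Fmor P Q g)].

Definition naturally_isomorphic (F : presented K -> operad K) (Fmor : hom_map F)
    (G : presented K -> operad K) (Gmor : hom_map G) : Prop :=
  [/\ is_functor Fmor, is_functor Gmor &
      exists phi : forall O, hom2 K (ogen (F O)) (ogen (G O)),
        (forall O, is_iso (phi O)) /\
        (forall O P f, @is_mor K O P f ->
           hom2_comp (phi O) (Gmor O P f) = hom2_comp (Fmor O P f) (phi P))].

End Constructions.

Arguments naturally_isomorphic {K} F Fmor G Gmor.

(* Main.v *)
From HB Require Import structures.
From mathcomp Require Import all_boot all_order all_algebra all_fingroup.
From mathcomp Require Import zify ring.
From Stdlib Require Import Classical.
Require Import Defs.
Set Implicit Arguments.
Unset Strict Implicit.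
Unset Printing Implicit Defensive.
Import GRing.Theory.
Local Open Scope ring_scope.

(** Both sides of each isomorphism are described by generators and relations, and
the generators correspond by an explicit signed bijection; the content is that
the relations correspond.

Black products.  Let R and S be all the ternary relations of Q and O.  The
relations of the white product of the Koszul duals are the elements mapped by
[tens3] into R^0 (x) F + F (x) S^0, where ^0 denotes annihilators, that is, the
elements orthogonal to all the products [hadamard r s] (r in R, s in S) in which
the coefficients of each tree are multiplied.  Taking annihilators once more, the
relations of the black product of Q and O are the linear combinations of the
[hadamard r s] ([black_relations], [black_min]).

Cochains.  Write F_e (x, y) and H_e (x, y) for the values of e on
(lambda x, sigma y) and (sigma x, lambda y).  Locality kills the products of
cochains at distinct vertices, and the Leibniz rule then shows that F_e and H_e
are also the values of e on (sigma x, rho y) and (rho x, sigma y), that e acts at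
either vertex by F_e + H_e, and by symmetry H_e is the opposite of F up to sign.
So F determines the whole structure.  Evaluate a relation s of O on one sigma and
two cochains at the vertices: (lambda, sigma, rho) gives the product [hadamard]
of s with the associator, F_e and - H_e standing for e times the product and e
times the opposite product.  By multilinearity all other evaluations follow from
this one and its permutations ([interval_op_relation]).  Without lambda the
evaluation on (sigma, rho, rho) remains, and it gives the right pre-Lie relation
in place of the associator ([rel_op_relation]).  Hence algebras over the black
product and dg algebra structures on cochains are the same thing.

From algebras to relations.  An identity that holds in all algebras over an
operad P is a relation of P: for each functional w vanishing on the relations
of P, a nilpotent P-algebra on three generators is built whose ternary products
are read off by w ([model_satisfies], [model_faithful], [black_complete]).

Com.  The map from Ass to Com sends the relations of Ass onto those of Com, so
the relations of the black product of Com and O are the images of those of the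
black product of Ass and O, and the induced map of generators is the quotient
map [com_proj] ([com_proj_black], [Com_bullet_relations]).

Naturality is an identity between matrices.  The black product is visibly
functorial, and functoriality of the left-hand sides follows by conjugation
([naturally_isomorphic_transport]). *)

(** * Linear algebra: annihilators of subspaces *)

Section Duality.
Variables (K : fieldType) (T : finType).
Implicit Types (u v w : {ffun T -> K^o}) (W : {ffun T -> K^o} -> Prop).

Definition dot u v : K := \sum_t u t * v t.

Definition subspace W := W 0 /\ forall (k : K) u v, W u -> W v -> W (k *: u + v).

Definition dirac (t : T) : {ffun T -> K^o} := [ffun t' => (t' == t)%:R].

Lemma dotC u v : dot u v = dot v u.
Proof. by apply: eq_bigr => t _; rewrite mulrC. Qed.

Lemma dotDl k u v w : dot (k *: u + v) w = k * dot u w + dot v w.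
Proof.
rewrite mulr_sumr -big_split /=; apply: eq_bigr => t _.
by rewrite !ffunE /= mulrDl mulrA.
Qed.

Lemma dot0l w : dot 0 w = 0.
Proof. by apply: big1 => t _; rewrite ffunE mul0r. Qed.

Lemma sum_dirac (U : nmodType) (F : T -> U) t :
  \sum_t' (if t' == t then F t' else 0) = F t.
Proof. by rewrite -big_mkcond big_pred1_eq. Qed.

Lemma dirac_expansion u : u = \sum_t u t *: dirac t.
Proof.
apply/ffunP=> t; rewrite sum_ffunE (bigD1 t) //= big1 ?addr0 => [|t' nt].
  by rewrite !ffunE eqxx /GRing.scale /= mulr1.
by rewrite !ffunE eq_sym (negPf nt) scaler0.
Qed.

Lemma subspaceZ W k u : subspace W -> W u -> W (k *: u).
Proof. by case=> W0 WD Wu; rewrite -[_ *: _]addr0; apply: WD. Qed.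

(** A subspace given by an arbitrary predicate need not be decidable, hence the
excluded middle: a detachable subspace contained in W is enlarged as long as it
misses a vector of W, and dimensions bound the number of steps. *)
Lemma subspace_vspace W : subspace W ->
  exists U : {vspace {ffun T -> K^o}}, forall u, W u <-> u \in U.
Proof.
move=> [W0 WD].
have main n : forall U : {vspace {ffun T -> K^o}},
    (forall u, u \in U -> W u) -> (\dim {:{ffun T -> K^o}} - \dim U <= n)%N ->
    exists U' : {vspace {ffun T -> K^o}}, forall u, W u <-> u \in U'.
  elim: n => [|n IHn] U sUW dimU.
    exists U => u; split=> [_|]; last exact: sUW.
    suff ->: U = fullv by apply: memvf.
    by apply/eqP; rewrite eqEdim subvf -subn_eq0 -leqn0.
  case: (classic (exists2 u, W u & u \notin U)) => [[u Wu uU]|no].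
    apply: (IHn (U + <[u]>)%VS) => [v /memv_addP[v1 Uv1 [_ /vlineP[k ->] ->]]|].
      by rewrite addrC; apply: WD => //; apply: sUW.
    have lt : (\dim U < \dim (U + <[u]>)%VS)%N.
      rewrite (ltn_leqif (dimv_leqif_sup _)) ?addvSl //.
      apply: contra uU => /subvP; apply.
      by apply: (subvP (addvSr _ _)); apply: memv_line.
    have := dimvS (subvf (U + <[u]>)); move: dimU lt; lia.
  exists U => u; split; last exact: sUW.
  by move=> Wu; apply/negPn/negP => uU; apply: no; exists u.
apply: (main _ 0%VS _ (leqnn _)) => u.
by rewrite memv0 => /eqP->.
Qed.

Lemma subspace_projection W : subspace W ->
  exists p : 'End({ffun T -> K^o}),
    (forall u, W (p u)) /\ (forall u, W u -> p u = u).
Proof.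
case/subspace_vspace=> U WU; exists (projv U); split=> u.
  by apply/WU; apply: memv_proj.
by move/WU; apply: projv_id.
Qed.

(** A subspace is the annihilator of its annihilator: if p is a projection onto W,
the coordinates of u - p u are functionals of u that vanish on W. *)
Lemma biorthogonal W u : subspace W ->
  (forall w, (forall v, W v -> dot v w = 0) -> dot u w = 0) -> W u.
Proof.
move=> subW Wu; have [p [Wp pW]] := subspace_projection subW.
pose w t : {ffun T -> K^o} := [ffun t' => (dirac t' - p (dirac t')) t].
have wE v t : dot v (w t) = (v - p v) t.
  rewrite [v in RHS]dirac_expansion linear_sum -sumrB sum_ffunE.
  apply: eq_bigr => t' _; rewrite linearZ -scalerBr !ffunE //.
suff ->: u = p u by [].
apply/eqP; rewrite -subr_eq0; apply/eqP/ffunP=> t; rewrite -wE ffunE; apply: Wu.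
by move=> v Wv; rewrite wE pW // subrr ffunE.
Qed.

End Duality.
Arguments dirac {K T} t.

(** (R (x) S)^0 = R^0 (x) F + F (x) S^0.  For p a projection onto R, the form
C (p -, -) kills S in its second variable and C - C (p -, -) kills R in its
first one. *)
Lemma annihilator_decomposition (K : fieldType) (T T' : finType)
    (R : {ffun T -> K^o} -> Prop) (S : {ffun T' -> K^o} -> Prop)
    (C : {ffun T * T' -> K^o}) :
  subspace R ->
  (forall r s, R r -> S s -> \sum_u \sum_v r u * s v * C (u, v) = 0) ->
  exists A B : {ffun T * T' -> K^o},
    [/\ C = A + B, forall v r, R r -> dot [ffun u => A (u, v)] r = 0
      & forall u s, S s -> dot [ffun v => B (u, v)] s = 0].
Proof.
move=> subR RSC; have [p [Rp pR]] := subspace_projection subR.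
pose B : {ffun T * T' -> K^o} :=
  [ffun t => \sum_u p (dirac t.1) u * C (u, t.2)].
exists (C - B), B; split; first by rewrite subrK.
  move=> v r Rr.
  transitivity (\sum_u (r - p r) u * C (u, v)); last first.
    by rewrite pR // subrr big1 // => u _; rewrite ffunE mul0r.
  transitivity (\sum_u r u * C (u, v) - \sum_u r u * B (u, v)).
    by rewrite -sumrB; apply: eq_bigr => u _; rewrite !ffunE mulrC mulrBr.
  transitivity (\sum_u r u * C (u, v) - \sum_u p r u * C (u, v)); last first.
    by rewrite -sumrB; apply: eq_bigr => u _; rewrite !ffunE mulrBl.
  congr (_ - _); rewrite [in RHS](dirac_expansion r) linear_sum.
  under eq_bigr do rewrite ffunE mulr_sumr.
  rewrite exchange_big; apply: eq_bigr => u _.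
  rewrite sum_ffunE mulr_suml; apply: eq_bigr => u' _.
  by rewrite linearZ !ffunE mulrA.
move=> u s Ss; rewrite -(RSC _ _ (Rp (dirac u)) Ss) exchange_big.
apply: eq_bigr => v _; rewrite !ffunE mulr_suml; apply: eq_bigr => u' _.
by rewrite mulrAC.
Qed.

(** * Ternary operations and the symmetric group on three variables *)

Lemma Z3_cases (c : 'Z_3) : [|| c == 0, c == 1 | c == 2].
Proof. by case: c => [[|[|[|]]]]. Qed.

Lemma Z3_ind (P : 'Z_3 -> Prop) : P 0 -> P 1 -> P 2 -> forall c, P c.
Proof. by move=> P0 P1 P2 c; case/or3P: (Z3_cases c) => /eqP->. Qed.

(** Three points on a circle have no other permutations than rotations and
reflections.  The action of S_3 on trees is therefore studied through [rotate]
and [mirror] only. *)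
Lemma perm_Z3_affine (s : {perm 'Z_3}) :
  (exists k, forall c, s c = c + k) \/ (exists k, forall c, s c = k - c).
Proof.
have sE a b : a != b -> s a != s b by rewrite (inj_eq perm_inj).
have := sE 0 1 isT; have := sE 0 2 isT; have := sE 1 2 isT.
case/or3P: (Z3_cases (s 0)) => /eqP s0; case/or3P: (Z3_cases (s 1)) => /eqP s1;
case/or3P: (Z3_cases (s 2)) => /eqP s2; rewrite s0 s1 s2 // => _ _ _;
  by [left; exists (s 0); elim/Z3_ind; rewrite s0 ?s1 ?s2; apply: val_inj
     |right; exists (s 0); elim/Z3_ind; rewrite s0 ?s1 ?s2; apply: val_inj].
Qed.

Lemma big_Z3 (U : Type) (idx : U) (op : Monoid.com_law idx) (F : 'Z_3 -> U) c :
  \big[op/idx]_a F a = op (op (F c) (F (c + 1))) (F (c + 2)).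
Proof.
have bigE : \big[op/idx]_a F a = op (op (F 0) (F 1)) (F 2).
  rewrite !big_ord_recl big_ord0 Monoid.mulm1 Monoid.mulmA.
  by congr (op (op _ _) _); congr (F _); apply/eqP.
rewrite bigE; elim/Z3_ind: c; rewrite ?add0r //.
  have -> : 1 + 1 = 2 :> 'Z_3 by apply: val_inj.
  have -> : 1 + 2 = 0 :> 'Z_3 by apply: val_inj.
  by rewrite -Monoid.mulmA Monoid.mulmC.
have -> : 2 + 1 = 0 :> 'Z_3 by apply: val_inj.
have -> : 2 + 2 = 1 :> 'Z_3 by apply: val_inj.
by rewrite Monoid.mulmC Monoid.mulmA.
Qed.

Lemma Z3_succ (c : 'Z_3) :
  [/\ c + 1 + 1 = c + 2, c + 1 + 2 = c, c + 2 + 1 = c & c + 2 + 2 = c + 1].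
Proof. by elim/Z3_ind: c; split; apply: val_inj. Qed.

Lemma Z3_point (T : Type) (c : 'Z_3) (x y z : T) :
  exists X : 'Z_3 -> T, [/\ X c = x, X (c + 1) = y & X (c + 2) = z].
Proof.
exists (fun a => if a == c then x else if a == c + 1 then y else z).
by elim/Z3_ind: c; split.
Qed.

Lemma sum_triple (U : nmodType) (I J L : finType) (F : I * J * L -> U) :
  \sum_i \sum_j \sum_l F (i, j, l) = \sum_t F t.
Proof.
rewrite pair_bigA /= pair_bigA /=.
by apply: eq_bigr => -[[i j] l].
Qed.

Section Ternary.
Variables (K : fieldType) (G : gens).
Implicit Types (u v r : ternary K G) (W : ternary K G -> Prop) (k : 'Z_3).

Definition rotate k r : ternary K G := [ffun t => r (t.1.1 - k, t.1.2, t.2)].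

(** Reflections reverse the order of the inner leaves of a tree, so they replace the
inner operation by its opposite. *)
Definition mirror k r : ternary K G :=
  [ffun t => (-1) ^+ gneg t.2 * r (k - t.1.1, t.1.2, gswap t.2)].

(** The monomial e_i (e_j (x_c, x_(c+1)), x_(c+2)). *)
Definition tree c i j : ternary K G := dirac (c, i, j).

Lemma lmonE a (i j : G) c : lmon K a (a + 1) c i j = tree a i j.
Proof. by apply/ffunP=> t; rewrite !ffunE eqxx. Qed.

Lemma lmonNE a (i j : G) c :
  lmon K (a + 1) a c i j = (-1) ^+ gneg j *: tree a i (gswap j).
Proof.
apply/ffunP=> t; rewrite !ffunE ifN //.
by rewrite -addrA -subr_eq0 opprD addNKr oppr_eq0.
Qed.

Lemma tactE s r : tact s r =
  \sum_t r t *: lmon K (s t.1.1) (s (t.1.1 + 1)) (s (t.1.1 + 2)) t.1.2 t.2.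
Proof. exact: (sum_triple (fun t => r t *: lmon K (s t.1.1) _ _ t.1.2 t.2)). Qed.

Lemma tact_rotate (s : {perm 'Z_3}) k r :
  (forall c, s c = c + k) -> tact s r = rotate k r.
Proof.
move=> sE; rewrite tactE; apply/ffunP=> t; rewrite sum_ffunE ffunE.
have sS c : s (c + 1) = s c + 1 by rewrite !sE addrAC.
rewrite (bigD1 (t.1.1 - k, t.1.2, t.2)) //= big1 ?addr0.
  rewrite sS lmonE /tree sE subrK -!surjective_pairing !ffunE.
  by rewrite eqxx /GRing.scale /= mulr1.
move=> [[c i] j] ne; rewrite sS lmonE /tree sE !ffunE.
rewrite (_ : _ == _ = false) ?scaler0 //; apply/eqP=> tE.
by move: ne; rewrite tE /= addrK eqxx.
Qed.

(** The shift by 1: the inner leaves c, c + 1 are sent to k - c and k - c - 1, and a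
tree is labelled by the first of its inner leaves in cyclic order. *)
Lemma tact_mirror (s : {perm 'Z_3}) k r :
  (forall c, s c = k - c) -> tact s r = mirror (k - 1) r.
Proof.
move=> sE; rewrite tactE; apply/ffunP=> t; rewrite sum_ffunE ffunE.
have kE c : s c = s (c + 1) + 1 by rewrite !sE opprD addrA subrK.
rewrite (bigD1 (k - 1 - t.1.1, t.1.2, gswap t.2)) //= big1 ?addr0.
  rewrite kE lmonNE /tree gswapK sE gneg_swap !ffunE.
  rewrite addrAC subrK subKr.
  by rewrite -!surjective_pairing eqxx /GRing.scale /= mulr1 mulrC.
move=> [[c i] j] ne; rewrite kE lmonNE /tree sE !ffunE.
rewrite (_ : _ == _ = false) ?mulr0 ?scaler0 //; apply/eqP=> tE.
by move: ne; rewrite tE /= gswapK opprB addrC addrA subrK addrK eqxx.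
Qed.

(** S_3-stable subspaces. *)
Definition submodule W := subspace W /\ forall s u, W u -> W (tact s u).

Lemma submoduleP W : subspace W ->
  (forall k u, W u -> W (rotate k u)) -> (forall k u, W u -> W (mirror k u)) ->
  submodule W.
Proof.
move=> subW rW mW; split=> // s u Wu.
case: (perm_Z3_affine s) => -[k sE].
  by rewrite (tact_rotate _ sE); apply: rW.
by rewrite (tact_mirror _ sE); apply: mW.
Qed.

Lemma submodule_rotate W k u : submodule W -> W u -> W (rotate k u).
Proof.
move=> [_ tW] Wu; rewrite -(@tact_rotate (perm (@addIr _ k))); first exact: tW.
by move=> c; rewrite permE.
Qed.

Lemma submodule_mirror W k u : submodule W -> W u -> W (mirror k u).
Proof.
move=> [_ tW] Wu; rewrite -[k](addrK 1).
rewrite -(@tact_mirror (perm (subrI (k + 1)))); first exact: tW.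
by move=> c; rewrite permE.
Qed.

Lemma tspan_submodule (S : ternary K G -> Prop) : submodule (tspan S).
Proof.
split; first split.
- by move=> W W0 WD Wt SW.
- by move=> k u v Su Sv W W0 WD Wt SW; exact: WD (Su W W0 WD Wt SW) (Sv W W0 WD Wt SW).
- by move=> s u Su W W0 WD Wt SW; exact: Wt (Su W W0 WD Wt SW).
Qed.

Lemma tspan_gen (S : ternary K G -> Prop) r : S r -> tspan S r.
Proof. by move=> Sr W W0 WD Wt SW; apply: SW. Qed.

Lemma tspan_min (S W : ternary K G -> Prop) :
  submodule W -> (forall r, S r -> W r) -> forall r, tspan S r -> W r.
Proof. by move=> [[W0 WD] Wt] SW r Sr; exact: (Sr W). Qed.

Lemma rotateD k a u v : rotate k (a *: u + v) = a *: rotate k u + rotate k v.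
Proof. by apply/ffunP=> t; rewrite !ffunE. Qed.

Lemma mirrorD k a u v : mirror k (a *: u + v) = a *: mirror k u + mirror k v.
Proof.
apply/ffunP=> t; rewrite !ffunE mulrDr; congr (_ + _).
by rewrite /GRing.scale /= mulrCA.
Qed.

Lemma rotateK k : cancel (rotate k) (rotate (- k)).
Proof. by move=> r; apply/ffunP=> -[[c i] j]; rewrite !ffunE /= opprK addrK. Qed.

Lemma mirrorK k : involutive (mirror k).
Proof.
move=> r; apply/ffunP=> -[[c i] j]; rewrite !ffunE /= gneg_swap gswapK subKr.
by rewrite mulrA -expr2 sqrr_sign mul1r.
Qed.

Lemma rotate_tree k c i j : rotate k (tree c i j) = tree (c + k) i j.
Proof.
apply/ffunP=> -[[c' i'] j']; rewrite !ffunE /= !xpair_eqE subr_eq //.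
Qed.

Lemma mirror_tree k c i j :
  mirror k (tree c i j) = (-1) ^+ gneg j *: tree (k - c) i (gswap j).
Proof.
apply/ffunP=> -[[c' i'] j']; rewrite !ffunE /= !xpair_eqE.
rewrite (can2_eq (@gswapK _) (@gswapK _)) (can2_eq (subKr k) (subKr k)).
have [->|] := eqVneq j' (gswap j); first by rewrite gneg_swap.
by rewrite !andbF !mulr0 scaler0.
Qed.

Lemma dot_rotate k u v : dot (rotate k u) v = dot u (rotate (- k) v).
Proof.
rewrite /dot (reindex (fun t : _ * G * G => (t.1.1 + k, t.1.2, t.2))) /=.
  by apply: eq_bigr => -[[c i] j] _; rewrite !ffunE /= addrK opprK.
exists (fun t => (t.1.1 - k, t.1.2, t.2)) => -[[c i] j] _ /=;
  by rewrite ?addrK ?subrK.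
Qed.

Lemma dot_mirror k u v : dot (mirror k u) v = dot u (mirror k v).
Proof.
rewrite /dot (reindex (fun t : _ * G * G => (k - t.1.1, t.1.2, gswap t.2))) /=.
  apply: eq_bigr => -[[c i] j] _; rewrite !ffunE /= subKr gneg_swap gswapK.
  by rewrite mulrCA mulrA.
apply/onW_bij; exists (fun t => (k - t.1.1, t.1.2, gswap t.2)) => -[[c i] j] /=;
  by rewrite subKr gswapK.
Qed.

End Ternary.

(** The sign of odd permutations that comes from O^!(2) = O(2)^* (x) sgn. *)
Lemma mirror_dual (K : fieldType) (G : gens) k (u : ternary K G) :
  @mirror K (gens_dual G) k u = - mirror k u.
Proof. by apply/ffunP=> t; rewrite !ffunE /= -mulNr; case: gneg; rewrite ?opprK. Qed.

(** * The relations of a black product *)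

Section BlackRelations.
Variable K : fieldType.
Implicit Types O P Q : operad K.

(** The generators O(2) (x) P(2) (x) sgn of a black product: three dualizations
leave one sign. *)
Definition gens_black (G H : gens) : gens :=
  gens_dual (gens_tens (gens_dual G) (gens_dual H)).

(** The transpose of [tens3]. *)
Definition hadamard (G H : gens) (r : ternary K G) (s : ternary K H) :
    ternary K (gens_black G H) :=
  [ffun t => r (t.1.1, t.1.2.1, t.2.1) * s (t.1.1, t.1.2.2, t.2.2)].

Lemma hadamardDl (G H : gens) a (r r' : ternary K G) (s : ternary K H) :
  hadamard (a *: r + r') s = a *: hadamard r s + hadamard r' s.
Proof. by apply/ffunP=> t; rewrite !ffunE /= mulrDl -scalerAl. Qed.

Lemma rotate_hadamard (G H : gens) k (r : ternary K G) (s : ternary K H) :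
  rotate k (hadamard r s) = hadamard (rotate k r) (rotate k s).
Proof. by apply/ffunP=> t; rewrite !ffunE. Qed.

Lemma mirror_hadamard (G H : gens) k (r : ternary K G) (s : ternary K H) :
  mirror k (hadamard r s) = - hadamard (mirror k r) (mirror k s).
Proof.
apply/ffunP=> -[[c [i i']] [j j']]; rewrite !ffunE /= /tens_neg /=.
by rewrite mulrACA; do 2! case: gneg; rewrite /= ?mulrN ?mulNr ?mulr1 ?mul1r ?opprK.
Qed.

Lemma orelations_submodule O : submodule (@orelations K O).
Proof. exact: tspan_submodule. Qed.

Lemma orelations_rotate O k r :
  @orelations K O r -> @orelations K O (rotate k r).
Proof. exact: submodule_rotate (orelations_submodule O). Qed.

Lemma orelations_mirror O k r :
  @orelations K O r -> @orelations K O (mirror k r).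
Proof. exact: submodule_mirror (orelations_submodule O). Qed.

Lemma dot_subspace (T : finType) (W : {ffun T -> K^o} -> Prop) :
  subspace (fun u => forall w, W w -> dot u w = 0).
Proof.
split=> [w _|a u v Wu Wv w Ww]; first exact: dot0l.
by rewrite dotDl Wu // Wv // mulr0 addr0.
Qed.

Lemma dotNl (T : finType) (u w : {ffun T -> K^o}) : dot (- u) w = - dot u w.
Proof. by rewrite -[- u]addr0 -scaleN1r dotDl dot0l addr0 mulN1r. Qed.

(** The pairing is S_3-invariant up to sign, so the annihilator of the relations is
already stable and generates nothing new. *)
Lemma koszul_dual_relations O (phi : ternary K (gens_dual (ogen O))) :
  @orelations K (koszul_dual O) phi <->
  (forall r, @orelations K O r -> dot (phi : ternary K (ogen O)) r = 0).
Proof.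
pose W (phi : ternary K (gens_dual (ogen O))) :=
  forall r, @orelations K O r -> dot (phi : ternary K (ogen O)) r = 0.
have WE u : @orel K (koszul_dual O) u <-> W u.
  by split=> Wu r /Wu; rewrite -?sum_triple // (sum_triple (fun t => u t * r t)).
suff subW : submodule W.
  split; first by apply: (tspan_min subW) => r /WE.
  by move/WE; apply: tspan_gen.
apply: submoduleP; first exact: (dot_subspace (@orelations K O)).
  by move=> k u Wu r Rr; rewrite dot_rotate; apply: Wu; apply: orelations_rotate.
move=> k u Wu r Rr; rewrite mirror_dual dotNl dot_mirror Wu ?oppr0 //.
exact: orelations_mirror.
Qed.

Definition kills_hadamard Q O (w : ternary K (gens_black (ogen Q) (ogen O))) :=
  forall r s, @orelations K Q r -> @orelations K O s -> dot w (hadamard r s) = 0.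

Lemma kills_hadamard_submodule Q O : submodule (@kills_hadamard Q O).
Proof.
apply: submoduleP.
- split=> [|a u v Wu Wv] r s Rr Rs; first exact: dot0l.
  by rewrite dotDl Wu // Wv // mulr0 addr0.
- move=> k u Wu r s Rr Rs; rewrite dot_rotate rotate_hadamard.
  by apply: Wu; apply: orelations_rotate.
move=> k u Wu r s Rr Rs; rewrite dot_mirror mirror_hadamard dotC dotNl dotC Wu ?oppr0 //.
  by apply: orelations_mirror.
by apply: orelations_mirror.
Qed.

Lemma dot_tens3 (G H : gens) (w : ternary K (gens_tens G H))
    (r : ternary K G) (s : ternary K H) :
  \sum_u \sum_v r u * s v * tens3 w (u, v) =
  dot (w : ternary K (gens_black G H)) (@hadamard G H r s).
Proof.
transitivity (\sum_c \sum_i \sum_j \sum_i' \sum_j'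
    r (c, i, j) * s (c, i', j') * w (c, (i, i'), (j, j'))).
  rewrite -sum_triple; apply: eq_bigr => c _; apply: eq_bigr => i _.
  apply: eq_bigr => j _; rewrite -sum_triple (bigD1 c) //= [X in _ + X]big1 ?addr0.
    apply: eq_bigr => i' _; apply: eq_bigr => j' _.
    by rewrite ffunE eqxx mul1r.
  move=> c' nc; rewrite big1 // => i' _; rewrite big1 // => j' _.
  by rewrite ffunE eq_sym (negPf nc) mul0r mulr0.
rewrite /dot -sum_triple; apply: eq_bigr => c _.
under eq_bigr do rewrite exchange_big.
rewrite pair_bigA; apply: eq_bigr => -[i i'] _ /=.
by rewrite pair_bigA; apply: eq_bigr => -[j j'] _ /=; rewrite ffunE mulrC.
Qed.

(** The condition of lying in R^0 (x) F + F (x) S^0 becomes orthogonality to the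
products of relations, a form in which stability under S_3 is visible. *)
Lemma white_relations Q O (w : ternary K (gens_tens (ogen Q) (ogen O))) :
  @orelations K (white (koszul_dual Q) (koszul_dual O)) w <-> @kills_hadamard Q O w.
Proof.
have main u : @orel K (white (koszul_dual Q) (koszul_dual O)) u <-> @kills_hadamard Q O u.
  split=> [[A [B [uE QA OB]]] r s Rr Rs|ku].
    have {}uE : @tens3 K (ogen Q) (ogen O) u = A + B := uE.
    rewrite -dot_tens3 uE.
    transitivity (\sum_v s v * dot [ffun u => A (u, v)] r
                  + \sum_u r u * dot [ffun v => B (u, v)] s).
      under [X in _ = X + _]eq_bigr do rewrite mulr_sumr.
      rewrite [X in _ = X + _]exchange_big -big_split; apply: eq_bigr => t _.
      rewrite mulr_sumr -big_split; apply: eq_bigr => t' _ /=.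
      rewrite !ffunE mulrDr; congr (_ + _).
        by rewrite mulrAC mulrC [r t * _]mulrC.
      by rewrite -mulrA [s t' * _]mulrC.
    rewrite !big1 ?addr0 // => t _.
      by rewrite ((koszul_dual_relations _).1 (OB t)) ?mulr0.
    by rewrite ((koszul_dual_relations _).1 (QA t)) ?mulr0.
  have [] := @annihilator_decomposition K _ _ (@orelations K Q) (@orelations K O)
    (@tens3 K (gens_dual (ogen Q)) (gens_dual (ogen O)) u).
  - by case: (orelations_submodule Q).
  - by move=> r s Rr Rs; rewrite dot_tens3; apply: ku.
  move=> A [B [uE QA OB]]; exists A, B; split=> //.
    by move=> v; apply/koszul_dual_relations => r; apply: QA.
  by move=> v; apply/koszul_dual_relations => r; apply: OB.
split=> [|kw]; last by apply: tspan_gen; apply/main.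
have [sub tsub] := kills_hadamard_submodule Q O.
apply: (@tspan_min K (ogen (white (koszul_dual Q) (koszul_dual O))) _
  (@kills_hadamard Q O)) => [|u /main//]; split=> // s u ku.
have := kills_hadamard_submodule Q O; case: (perm_Z3_affine s) => -[k sE] subW.
  rewrite (tact_rotate _ sE).
  exact: (@submodule_rotate K (gens_black (ogen Q) (ogen O)) _ k u subW ku).
rewrite (tact_mirror _ sE).
have := @submodule_mirror K (gens_black (ogen Q) (ogen O)) _ (k - 1) u subW ku.
by rewrite mirror_dual => /(subspaceZ (-1) sub); rewrite scaleN1r opprK.
Qed.

Lemma black_relations Q O phi :
  @orelations K (black Q O) phi <-> (forall w, @kills_hadamard Q O w -> dot phi w = 0).
Proof.
by split=> [/koszul_dual_relations H w /white_relations|H];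
  [apply: H|apply/koszul_dual_relations=> w /white_relations; apply: H].
Qed.

Lemma black_hadamard Q O r s :
  @orelations K Q r -> @orelations K O s -> @orelations K (black Q O) (hadamard r s).
Proof. by move=> Rr Rs; apply/black_relations=> w kw; rewrite dotC kw. Qed.

(** The relations of a black product are spanned by the products of relations; in
the form of an induction principle, to avoid naming the span. *)
Lemma black_min Q O W : subspace W ->
  (forall r s, @orelations K Q r -> @orelations K O s -> W (hadamard r s)) ->
  forall phi, @orelations K (black Q O) phi -> W phi.
Proof.
move=> subW RSW phi /black_relations Bphi; apply: (biorthogonal subW) => w Ww.
by apply: Bphi => r s Rr Rs; rewrite dotC Ww //; apply: RSW.
Qed.

End BlackRelations.

(** * Morphisms of operads and functors *)

Section Morphisms.
Variable K : fieldType.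
Implicit Types G H L : gens.

Lemma hom2_compA G H L M (f : hom2 K G H) (g : hom2 K H L) (h : hom2 K L M) :
  hom2_comp f (hom2_comp g h) = hom2_comp (hom2_comp f g) h.
Proof.
apply/ffunP=> t; rewrite !ffunE; under eq_bigr do rewrite ffunE mulr_sumr.
rewrite exchange_big; apply: eq_bigr => j _; rewrite ffunE mulr_suml.
by apply: eq_bigr => i _ /=; rewrite mulrA.
Qed.

Lemma hom2_comp1f G H (f : hom2 K G H) : hom2_comp (hom2_id K G) f = f.
Proof.
apply/ffunP=> -[i j]; rewrite ffunE /= (bigD1 i) //= big1 => [|k ne].
  by rewrite ffunE eqxx mul1r addr0.
by rewrite ffunE /= eq_sym (negPf ne) mul0r.
Qed.

Lemma hom2_compf1 G H (f : hom2 K G H) : hom2_comp f (hom2_id K H) = f.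
Proof.
apply/ffunP=> -[i j]; rewrite ffunE /= (bigD1 j) //= big1 => [|k ne].
  by rewrite ffunE eqxx mulr1 addr0.
by rewrite ffunE /= (negPf ne) mulr0.
Qed.

(** The matrix of the transposition acting on generators: equivariance is
commutation with it, which makes it stable under composition and inverses. *)
Definition hom2_swap G : hom2 K G G :=
  [ffun t => (-1) ^+ gneg t.1 * (t.2 == gswap t.1)%:R].

Lemma equivariant2_comm G H (f : hom2 K G H) :
  equivariant2 f <-> hom2_comp (hom2_swap G) f = hom2_comp f (hom2_swap H).
Proof.
have lE i j : hom2_comp (hom2_swap G) f (i, j) = (-1) ^+ gneg i * f (gswap i, j).
  rewrite ffunE /= (bigD1 (gswap i)) //= big1 => [|k ne].
    by rewrite ffunE /= eqxx mulr1 addr0.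
  by rewrite ffunE /= (negPf ne) mulr0 mul0r.
have rE i j : hom2_comp f (hom2_swap H) (i, j) = (-1) ^+ gneg j * f (i, gswap j).
  rewrite ffunE /= (bigD1 (gswap j)) //= big1 => [|k ne].
    by rewrite ffunE /= gneg_swap gswapK eqxx mulr1 addr0 mulrC.
  rewrite [hom2_swap H _]ffunE /= (_ : j == gswap k = false) ?mulr0 //.
  by apply: contraNF ne => /eqP->; rewrite gswapK.
split=> [fE|fE i j].
  apply/ffunP=> -[i j]; rewrite lE rE -{1}[j]gswapK fE gneg_swap.
  by rewrite signr_addb mulrA mulrA -expr2 sqrr_sign mul1r.
have := congr1 (fun h : hom2 K G H => (-1) ^+ gneg i * h (i, gswap j)) fE.
rewrite lE rE !mulrA -expr2 sqrr_sign mul1r gswapK gneg_swap => ->.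
by rewrite signr_addb.
Qed.

Lemma equivariant2_comp G H L (f : hom2 K G H) (g : hom2 K H L) :
  equivariant2 f -> equivariant2 g -> equivariant2 (hom2_comp f g).
Proof.
move=> /equivariant2_comm fE /equivariant2_comm gE; apply/equivariant2_comm.
by rewrite hom2_compA fE -hom2_compA gE hom2_compA.
Qed.

Lemma equivariant2_id G : equivariant2 (hom2_id K G).
Proof. by apply/equivariant2_comm; rewrite hom2_comp1f hom2_compf1. Qed.

Lemma equivariant2_inv G H (f : hom2 K G H) (g : hom2 K H G) :
  hom2_comp f g = hom2_id K G -> hom2_comp g f = hom2_id K H ->
  equivariant2 f -> equivariant2 g.
Proof.
move=> fg gf /equivariant2_comm fE; apply/equivariant2_comm.
rewrite -[hom2_comp (hom2_swap H) g]hom2_comp1f -gf -hom2_compA.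
by rewrite [hom2_comp f _]hom2_compA -fE -hom2_compA fg hom2_compf1.
Qed.

Lemma hom3D G H (f : hom2 K G H) a u v :
  hom3 f (a *: u + v) = a *: hom3 f u + hom3 f v.
Proof.
apply/ffunP=> t; rewrite !ffunE scaler_sumr -big_split; apply: eq_bigr => i _.
rewrite scaler_sumr -big_split; apply: eq_bigr => j _ /=.
by rewrite !ffunE !mulrDl; congr (_ + _); rewrite /GRing.scale /= !mulrA.
Qed.

Lemma hom3_id G (r : ternary K G) : hom3 (hom2_id K G) r = r.
Proof.
apply/ffunP=> -[[c i] j]; rewrite ffunE /= (bigD1 i) //= [X in _ + X]big1 ?addr0.
  rewrite (bigD1 j) //= big1 ?addr0 => [|j' ne]; first by rewrite !ffunE !eqxx !mulr1.
  by rewrite !ffunE /= (negPf ne) mulr0.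
by move=> i' ne; rewrite big1 // => j' _; rewrite !ffunE /= (negPf ne) mulr0 mul0r.
Qed.

Lemma hom3_comp G H L (f : hom2 K G H) (g : hom2 K H L) r :
  hom3 (hom2_comp f g) r = hom3 g (hom3 f r).
Proof.
apply/ffunP=> -[[c i] j]; rewrite !ffunE /=.
transitivity (\sum_a \sum_b \sum_i' \sum_j'
    r (c, a, b) * f (a, i') * f (b, j') * g (i', i) * g (j', j)).
  apply: eq_bigr => a _; apply: eq_bigr => b _; rewrite !ffunE /=.
  rewrite mulr_sumr [RHS]exchange_big; apply: eq_bigr => j' _.
  rewrite mulr_sumr mulr_suml; apply: eq_bigr => i' _.
  by rewrite !mulrA; congr (_ * _); rewrite mulrAC.
transitivity (\sum_i' \sum_j' \sum_a \sum_b
    r (c, a, b) * f (a, i') * f (b, j') * g (i', i) * g (j', j)).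
  under eq_bigr do rewrite exchange_big; rewrite exchange_big /=.
  apply: eq_bigr => i' _; under eq_bigr do rewrite exchange_big.
  by rewrite exchange_big.
apply: eq_bigr => i' _; apply: eq_bigr => j' _; rewrite ffunE /= !mulr_suml.
by apply: eq_bigr => a _; rewrite !mulr_suml.
Qed.

Lemma hom3_rotate G H (f : hom2 K G H) k r :
  hom3 f (rotate k r) = rotate k (hom3 f r).
Proof.
apply/ffunP=> t; rewrite !ffunE /=.
by apply: eq_bigr => i _; apply: eq_bigr => j _; rewrite ffunE.
Qed.

Lemma hom3_mirror G H (f : hom2 K G H) k r : equivariant2 f ->
  hom3 f (mirror k r) = mirror k (hom3 f r).
Proof.
move=> fE; apply/ffunP=> -[[c i] j]; rewrite !ffunE /= mulr_sumr.
apply: eq_bigr => a _; rewrite (reindex_inj (can_inj (@gswapK G))) mulr_sumr.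
apply: eq_bigr => b _ /=; rewrite ffunE /= gswapK gneg_swap.
rewrite -{1}[j]gswapK fE gneg_swap signr_addb.
by case: (gneg b); case: (gneg j);
  rewrite ?expr1 ?expr0 ?mulN1r ?mul1r ?mulNr ?mulrN ?mul1r ?mulNr ?opprK.
Qed.

Lemma submodule_preim G H (f : hom2 K G H) W : equivariant2 f ->
  submodule W -> submodule (fun r => W (hom3 f r)).
Proof.
move=> fE subW; apply: submoduleP.
- split=> [|a u v Wu Wv].
    rewrite (_ : hom3 f 0 = 0); first by case: subW => -[].
    have := hom3D f (-1) 0 0; rewrite scaleN1r oppr0 addr0 scaleN1r addrC subrr.
    by [].
  by rewrite hom3D; case: subW => -[_ WD] _; apply: WD.
- by move=> k u Wu; rewrite hom3_rotate; apply: (submodule_rotate k subW).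
- by move=> k u Wu; rewrite hom3_mirror //; apply: (submodule_mirror k subW).
Qed.

Lemma submodule_image G H (f : hom2 K G H) W : equivariant2 f ->
  submodule W -> submodule (fun r => exists2 r', W r' & r = hom3 f r').
Proof.
move=> fE subW; apply: submoduleP.
- split=> [|a u v [u' Wu ->] [v' Wv ->]].
    exists 0; first by case: subW => -[].
    by apply/ffunP=> t; rewrite !ffunE big1 // => i _; rewrite big1 // => j _;
      rewrite ffunE !mul0r.
  by exists (a *: u' + v'); [case: subW => -[_ WD] _; apply: WD|rewrite hom3D].
- move=> k _ [u Wu ->]; exists (rotate k u); last by rewrite hom3_rotate.
  exact: (submodule_rotate k subW).
- move=> k _ [u Wu ->]; exists (mirror k u); last by rewrite hom3_mirror.
  exact: (submodule_mirror k subW).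
Qed.

Implicit Types O P Q : operad K.

Lemma is_mor_gen O P (f : hom2 K (ogen O) (ogen P)) : equivariant2 f ->
  (forall r, @orel K O r -> @orelations K P (hom3 f r)) -> is_mor f.
Proof.
move=> fE fR; split=> //; apply: tspan_min fR.
exact: submodule_preim (orelations_submodule P).
Qed.

Lemma is_mor_id O : @is_mor K O O (hom2_id K _).
Proof. by split; [apply: equivariant2_id|move=> r; rewrite hom3_id]. Qed.

Lemma is_mor_comp O P Q f g :
  @is_mor K O P f -> @is_mor K P Q g -> @is_mor K O Q (hom2_comp f g).
Proof.
move=> [fE fR] [gE gR]; split; first exact: equivariant2_comp.
by move=> r Rr; rewrite hom3_comp; exact: gR (fR _ Rr).
Qed.

(** It suffices to compare [orel], because the hypothesis shows that the presenting
relations of O are already stable. *)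
Lemma is_iso_of_relations O P (f : hom2 K (ogen O) (ogen P)) g :
  equivariant2 f -> hom2_comp f g = hom2_id K _ -> hom2_comp g f = hom2_id K _ ->
  (forall r, @orel K O r <-> @orelations K P (hom3 f r)) -> is_iso f.
Proof.
move=> fE fg gf fR; have gE := equivariant2_inv fg gf fE.
split; first by apply: is_mor_gen => // r /fR.
exists g; split=> //; split=> // r Rr.
by apply: tspan_gen; apply/fR; rewrite -hom3_comp gf hom3_id.
Qed.

End Morphisms.

Section BlackFunctor.
Variable K : fieldType.

Lemma black_morE (G G' H H' : gens) (f : hom2 K G G') (g : hom2 K H H') i j i' j' :
  black_mor f g ((i, j), (i', j')) = f (i, i') * g (j, j').
Proof. by rewrite !ffunE. Qed.

Lemma black_mor_equivariant2 (G G' H H' : gens) (f : hom2 K G G') (g : hom2 K H H') :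
  equivariant2 f -> equivariant2 g -> equivariant2 (black_mor f g).
Proof.
move=> fE gE [i j] [i' j']; rewrite !black_morE fE gE mulrACA; congr (_ * _).
rewrite /= /tens_neg /= -signr_addb.
by case: gneg; case: gneg; case: gneg; case: gneg.
Qed.

(** Functoriality of the black product on spanning relations. *)
Lemma hom3_hadamard (G G' H H' : gens) (f : hom2 K G G') (g : hom2 K H H') r s :
  hom3 (black_mor f g) (hadamard r s) = hadamard (hom3 f r) (hom3 g s).
Proof.
apply/ffunP=> -[[c [i i']] [j j']]; rewrite !ffunE /=.
transitivity (\sum_a \sum_a' \sum_b \sum_b'
    r (c, a, b) * f (a, i) * f (b, j) * (s (c, a', b') * g (a', i') * g (b', j'))).
  rewrite [RHS]pair_bigA; apply: eq_bigr => -[a a'] _ /=.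
  rewrite [RHS]pair_bigA; apply: eq_bigr => -[b b'] _ /=.
  rewrite !black_morE ffunE /=.
  by rewrite [RHS]mulrACA [r _ * f _ * _]mulrACA.
rewrite mulr_suml; apply: eq_bigr => a _.
rewrite exchange_big mulr_suml; apply: eq_bigr => b _.
rewrite mulr_sumr; apply: eq_bigr => a' _.
by rewrite mulr_sumr.
Qed.

Lemma black_mor_is_mor (Q Q' O P : operad K) f g :
  @is_mor K Q Q' f -> @is_mor K O P g ->
  @is_mor K (black Q O) (black Q' P) (black_mor f g).
Proof.
move=> [fE fR] [gE gR]; have bE := black_mor_equivariant2 fE gE.
split=> //; apply: black_min.
  by case: (submodule_preim bE (orelations_submodule (black Q' P))).
move=> r s Rr Rs; rewrite hom3_hadamard.
by apply: black_hadamard; [apply: fR|apply: gR].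
Qed.

Lemma black_mor_id (G H : gens) :
  black_mor (hom2_id K G) (hom2_id K H) = hom2_id K (gens_black G H).
Proof.
apply/ffunP=> -[[i j] [i' j']]; rewrite black_morE !ffunE /= xpair_eqE.
by rewrite -natrM mulnb.
Qed.

Lemma black_mor_comp (G G' G'' H H' H'' : gens) (f : hom2 K G G')
    (f' : hom2 K G' G'') (g : hom2 K H H') (g' : hom2 K H' H'') :
  hom2_comp (black_mor f g) (black_mor f' g') =
  black_mor (hom2_comp f f') (hom2_comp g g').
Proof.
apply/ffunP=> -[[i j] [i' j']]; rewrite black_morE !ffunE /=.
rewrite mulr_suml; under [RHS]eq_bigr do rewrite mulr_sumr.
rewrite pair_bigA; apply: eq_bigr => -[a b] _ /=.
by rewrite !black_morE mulrACA.
Qed.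

Lemma black_left_functor (Q : operad K) : is_functor (@black_left_mor K Q).
Proof.
split=> [O P f fM|O|O P P' f g fM gM].
- exact: black_mor_is_mor (is_mor_id Q) fM.
- exact: black_mor_id.
- by rewrite /black_left_mor -{1}(hom2_comp1f (hom2_id K _)) -black_mor_comp.
Qed.

(** By naturality Fmor f is the conjugate of Gmor f by the isomorphisms, so that F
inherits functoriality from G. *)
Lemma naturally_isomorphic_transport (F : presented K -> operad K) (Fmor : hom_map F)
    (G : presented K -> operad K) (Gmor : hom_map G) phi :
  is_functor Gmor -> (forall O, @is_iso K (F O) (G O) (phi O)) ->
  (forall (O P : presented K) f, @is_mor K O P f ->
     hom2_comp (phi O) (Gmor O P f) = hom2_comp (Fmor O P f) (phi P)) ->
  naturally_isomorphic F Fmor G Gmor.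
Proof.
move=> GF phi_iso phi_nat; split=> //; last by exists phi.
case: GF => G_mor G_id G_comp.
have FE (O P : presented K) f psi : @is_mor K O P f -> hom2_comp (phi P) psi = hom2_id K _ ->
    Fmor O P f = hom2_comp (hom2_comp (phi O) (Gmor O P f)) psi.
  by move=> /phi_nat-> phiK; rewrite -hom2_compA phiK hom2_compf1.
split=> [O P f fM|O|O P Q f g fM gM].
- have [_ [psi [psi_mor phiK _]]] := phi_iso P; rewrite (FE _ _ _ psi) //.
  have [phi_mor _] := phi_iso O; apply: is_mor_comp psi_mor.
  exact: is_mor_comp phi_mor (G_mor _ _ _ fM).
- have [_ [psi [_ phiK _]]] := phi_iso O.
  by rewrite (FE _ _ _ psi) ?G_id ?hom2_compf1 //; apply: is_mor_id.
- have [_ [psi [_ phiK _]]] := phi_iso Q.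
  have fgM := is_mor_comp fM gM.
  rewrite (FE _ _ _ psi fgM phiK) G_comp // (FE _ _ _ psi gM phiK).
  by rewrite !hom2_compA phi_nat.
Qed.

End BlackFunctor.

(** * Evaluation of ternary operations *)

Section Bilinear.
Variables (K : fieldType) (V : lmodType K) (m : V -> V -> V).
Hypothesis mbil : bilinear2 m.

Lemma bilinear2Dl x y z : m (x + y) z = m x z + m y z.
Proof. by have := mbil.2 z 1 x y; rewrite !scale1r. Qed.

Lemma bilinear2Dr x y z : m x (y + z) = m x y + m x z.
Proof. by have := mbil.1 x 1 y z; rewrite !scale1r. Qed.

Lemma bilinear20l x : m 0 x = 0.
Proof. by apply: (@addrI _ (m 0 x)); rewrite -bilinear2Dl !addr0. Qed.

Lemma bilinear20r x : m x 0 = 0.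
Proof. by apply: (@addrI _ (m x 0)); rewrite -bilinear2Dr !addr0. Qed.

Lemma bilinear2Zl a x y : m (a *: x) y = a *: m x y.
Proof. by have := mbil.2 y a x 0; rewrite bilinear20l !addr0. Qed.

Lemma bilinear2Zr a x y : m x (a *: y) = a *: m x y.
Proof. by have := mbil.1 x a y 0; rewrite bilinear20r !addr0. Qed.

Lemma bilinear2Nl x y : m (- x) y = - m x y.
Proof. by rewrite -scaleN1r bilinear2Zl scaleN1r. Qed.

Lemma bilinear2Nr x y : m x (- y) = - m x y.
Proof. by rewrite -scaleN1r bilinear2Zr scaleN1r. Qed.

Lemma bilinear2_suml (I : finType) (F : I -> V) y :
  m (\sum_i F i) y = \sum_i m (F i) y.
Proof.
by elim/big_rec2: _ => [|i x z _ <-]; rewrite ?bilinear20l ?bilinear2Dl.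
Qed.

End Bilinear.

Section Evaluation.
Variable K : fieldType.

(** The contribution to r (x, y, z) of the trees with inner leaves c, c + 1.  The
operations at the root and inside are interpreted separately: for cochains on
the interval they act on cochains of different kinds. *)
Definition branch (G : gens) (V : lmodType K) (F H : G -> V -> V -> V)
    (r : ternary K G) (c : 'Z_3) (x y z : V) : V :=
  \sum_i \sum_j r (c, i, j) *: F i (H j x y) z.

(** [teval] without Koszul signs. *)
Definition eval3 (G : gens) (V : lmodType K) (n : G -> V -> V -> V)
    (x : 'Z_3 -> V) (r : ternary K G) : V :=
  \sum_t r t *: n t.1.2 (n t.2 (x t.1.1) (x (t.1.1 + 1))) (x (t.1.1 + 2)).

Lemma eval3_branch (G : gens) (V : lmodType K) (n : G -> V -> V -> V) x r :
  eval3 n x r = \sum_c branch n n r c (x c) (x (c + 1)) (x (c + 2)).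
Proof. by rewrite /eval3 -sum_triple. Qed.

Lemma teval_eval3 (G : gens) (V : lmodType K) (n : G -> V -> V -> V) d x r :
  (forall c, ~~ odd (koszul_exp d c)) -> teval n d x r = eval3 n x r.
Proof.
move=> d0; rewrite /eval3 -sum_triple; apply: eq_bigr => c _.
by rewrite -signr_odd (negPf (d0 c)); do 2!apply: eq_bigr => ? _; rewrite mul1r.
Qed.

Lemma satisfiesE (G : gens) (V : lmodType K) (n : G -> V -> V -> V) r :
  satisfies n r <-> forall x, eval3 n x r = 0.
Proof.
have d0 c : ~~ odd (koszul_exp (fun=> 0%N) c).
  by rewrite /koszul_exp; case: ifP => // _; case: ifP.
by split=> nr x; have := nr x; rewrite teval_eval3.
Qed.

Lemma eval3D (G : gens) (V : lmodType K) (n : G -> V -> V -> V) x a u v :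
  eval3 n x (a *: u + v) = a *: eval3 n x u + eval3 n x v.
Proof.
rewrite scaler_sumr -big_split; apply: eq_bigr => t _ /=.
by rewrite !ffunE scalerDl scalerA.
Qed.

Lemma satisfies_subspace (G : gens) (V : lmodType K) (n : G -> V -> V -> V) :
  subspace (satisfies n).
Proof.
split=> [|a u v /satisfiesE nu /satisfiesE nv]; apply/satisfiesE=> x.
  by apply: big1 => t _; rewrite ffunE scale0r.
by rewrite eval3D nu nv scaler0 addr0.
Qed.

Lemma satisfies_submodule (G : gens) (V : lmodType K) (n : G -> V -> V -> V) :
  is_operations n -> submodule (satisfies n).
Proof.
move=> [nbil nsym]; apply: submoduleP; first exact: satisfies_subspace.
  move=> k u /satisfiesE nu; apply/satisfiesE => x.
  rewrite -[RHS](nu (fun c => x (c + k))) /eval3.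
  rewrite (reindex_inj (can_inj (_ : cancel (fun t : 'Z_3 * G * G => (t.1.1 + k, t.1.2, t.2))
    (fun t => (t.1.1 - k, t.1.2, t.2))))) /=; last by move=> [[c i] j]; rewrite /= addrK.
  by apply: eq_bigr => -[[c i] j] _; rewrite ffunE /= addrK ![_ + k + _]addrAC.
move=> k u /satisfiesE nu; apply/satisfiesE => x.
rewrite -[RHS](nu (fun c => x (k - c + 1))) /eval3.
rewrite (reindex_inj (inv_inj (_ : involutive
  (fun t : 'Z_3 * G * G => (k - t.1.1, t.1.2, gswap t.2))))) /=; last first.
  by move=> [[c i] j]; rewrite /= subKr gswapK.
apply: eq_bigr => -[[c i] j] _; rewrite ffunE /= subKr gswapK gneg_swap.
have -> : k - (c + 1) + 1 = k - c by rewrite opprD addrA subrK.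
have -> : k - (c + 2) + 1 = k - c + 2.
  by rewrite opprD addrA -[_ - 2 + 1]addrA; congr (_ + _); apply: val_inj.
rewrite (nsym j) (bilinear2Zl (nbil i)) scalerA; congr (_ *: _).
by rewrite mulrC.
Qed.

Definition pull_op (G H : gens) (V : lmodType K) (f : hom2 K G H)
    (n : H -> V -> V -> V) (i : G) (x y : V) : V :=
  \sum_j f (i, j) *: n j x y.

Lemma pull_operations (G H : gens) (V : lmodType K) (f : hom2 K G H)
    (n : H -> V -> V -> V) :
  equivariant2 f -> is_operations n -> is_operations (pull_op f n).
Proof.
move=> fE [nbil nsym]; split=> [i|i x y].
  split=> z a x y; rewrite /pull_op scaler_sumr -big_split; apply: eq_bigr => j _ /=.
    by rewrite (nbil j).1 scalerDr !scalerA mulrC.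
  by rewrite (nbil j).2 scalerDr !scalerA mulrC.
rewrite /pull_op scaler_sumr [RHS](reindex_inj (can_inj (@gswapK H))).
apply: eq_bigr => j _; rewrite nsym fE signr_addb !scalerA mulrA mulrA.
by rewrite -expr2 sqrr_sign mul1r mulrC.
Qed.

Lemma eval3_pull (G H : gens) (V : lmodType K) (f : hom2 K G H)
    (n : H -> V -> V -> V) x r :
  (forall i, bilinear2 (n i)) ->
  eval3 (pull_op f n) x r = eval3 n x (hom3 f r).
Proof.
move=> nbil; rewrite /eval3 -!sum_triple; apply: eq_bigr => c _.
transitivity (\sum_i \sum_j \sum_i' \sum_j' (r (c, i, j) * f (i, i') * f (j, j')) *:
   n i' (n j' (x c) (x (c + 1))) (x (c + 2))).
  apply: eq_bigr => i _; apply: eq_bigr => j _.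
  rewrite scaler_sumr; apply: eq_bigr => i' _.
  rewrite (bilinear2_suml (nbil i')) !scaler_sumr; apply: eq_bigr => j' _.
  by rewrite (bilinear2Zl (nbil i')) !scalerA.
transitivity (\sum_i' \sum_j' \sum_i \sum_j (r (c, i, j) * f (i, i') * f (j, j')) *:
   n i' (n j' (x c) (x (c + 1))) (x (c + 2))).
  under eq_bigr do rewrite exchange_big; rewrite exchange_big /=.
  apply: eq_bigr => i' _; under eq_bigr do rewrite exchange_big.
  by rewrite exchange_big.
apply: eq_bigr => i' _; apply: eq_bigr => j' _; rewrite ffunE /= scaler_suml.
by apply: eq_bigr => a _; rewrite scaler_suml.
Qed.

(** Multiplying r by a tree of the first operad selects the branch c of r, and marks
the root and the inner operation of r by those of the tree. *)
Lemma eval3_hadamard_tree (G H : gens) (V : lmodType K)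
    (n : gens_black G H -> V -> V -> V) x c i j s :
  eval3 n x (hadamard (tree K c i j) s) =
  branch (fun i' => n (i, i')) (fun j' => n (j, j')) s c (x c) (x (c + 1)) (x (c + 2)).
Proof.
rewrite /eval3 -sum_triple (bigD1 c) //= [X in _ + X]big1 ?addr0; last first.
  move=> c' nc; rewrite big1 // => i' _; rewrite big1 // => j' _.
  by rewrite !ffunE /= !xpair_eqE (negPf nc) mul0r scale0r.
transitivity (\sum_a \sum_i' \sum_b \sum_j'
    (tree K c i j (c, a, b) * s (c, i', j')) *:
    n (a, i') (n (b, j') (x c) (x (c + 1))) (x (c + 2))).
  rewrite [RHS]pair_bigA; apply: eq_bigr => -[a i'] _ /=.
  by rewrite [RHS]pair_bigA; apply: eq_bigr => -[b j'] _ /=; rewrite ffunE.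
rewrite (bigD1 i) //= [X in _ + X]big1 ?addr0; last first.
  move=> a ne; rewrite big1 // => i' _; rewrite big1 // => b _.
  by rewrite big1 // => j' _; rewrite /tree ffunE !xpair_eqE (negPf ne) andbF mul0r scale0r.
apply: eq_bigr => i' _; rewrite (bigD1 j) //= [X in _ + X]big1 ?addr0; last first.
  move=> b ne; rewrite big1 // => j' _.
  by rewrite /tree ffunE !xpair_eqE (negPf ne) !andbF mul0r scale0r.
by apply: eq_bigr => j' _; rewrite /tree ffunE eqxx mul1r.
Qed.

End Evaluation.

Section Branches.
Variables (K : fieldType) (G : gens) (V : lmodType K).
Implicit Types (F H : G -> V -> V -> V) (r : ternary K G).

Lemma branchDl F F' H r c x y z :
  branch (fun e u v => F e u v + F' e u v) H r c x y z =
  branch F H r c x y z + branch F' H r c x y z.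
Proof.
rewrite -big_split; apply: eq_bigr => i _; rewrite -big_split.
by apply: eq_bigr => j _; rewrite scalerDr.
Qed.

Lemma branchDr F H H' r c x y z : (forall e, bilinear2 (F e)) ->
  branch F (fun e u v => H e u v + H' e u v) r c x y z =
  branch F H r c x y z + branch F H' r c x y z.
Proof.
move=> Fbil; rewrite -big_split; apply: eq_bigr => i _; rewrite -big_split.
by apply: eq_bigr => j _; rewrite (bilinear2Dl (Fbil i)) scalerDr.
Qed.

End Branches.

Section LinearMaps.
Variables (K : fieldType) (U V : lmodType K) (p : U -> V).
Hypothesis plin : linear p.

Lemma linear_map0 : p 0 = 0.
Proof.
by apply: (@addrI _ (p 0)); have := plin 1 0 0; rewrite !scale1r !addr0.
Qed.

Lemma linear_mapD x y : p (x + y) = p x + p y.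
Proof. by have := plin 1 x y; rewrite !scale1r. Qed.

Lemma linear_mapZ a x : p (a *: x) = a *: p x.
Proof. by have := plin a x 0; rewrite linear_map0 !addr0. Qed.

Lemma linear_map_sum (I : finType) (E : I -> U) : p (\sum_i E i) = \sum_i p (E i).
Proof. exact: (big_morph p linear_mapD linear_map0). Qed.

End LinearMaps.

Section Transport.
Variables (K : fieldType) (G : gens) (U V : lmodType K).

Lemma branch_linear (p : V -> U) (m m' : G -> U -> U -> U)
    (F H : G -> V -> V -> V) (r : ternary K G) c u v w x y z :
  linear p -> (forall i j, m i (m' j u v) w = p (F i (H j x y) z)) ->
  branch m m' r c u v w = p (branch F H r c x y z).
Proof.
move=> plin mp; rewrite (linear_map_sum plin); apply: eq_bigr => i _.
rewrite (linear_map_sum plin); apply: eq_bigr => j _.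
by rewrite mp (linear_mapZ plin).
Qed.

Lemma eval3_linear (p : U -> V) (m : G -> U -> U -> U) (F : G -> V -> V -> V)
    (x : 'Z_3 -> U) (r : ternary K G) :
  linear p -> (forall e u v, p (m e u v) = F e (p u) (p v)) ->
  p (eval3 m x r) = eval3 F (fun a => p (x a)) r.
Proof.
move=> plin mp; rewrite (linear_map_sum plin); apply: eq_bigr => t _.
by rewrite (linear_mapZ plin) !mp.
Qed.

Lemma eval3_rotation (m : G -> U -> U -> U) (x : 'Z_3 -> U) (r : ternary K G) s :
  eval3 m x r = branch m m r s (x s) (x (s + 1)) (x (s + 2))
    + branch m m r (s + 1) (x (s + 1)) (x (s + 2)) (x s)
    + branch m m r (s + 2) (x (s + 2)) (x s) (x (s + 1)).
Proof.
rewrite eval3_branch (big_Z3 _ _ s) /=.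
by have [-> -> -> ->] := Z3_succ s.
Qed.

Lemma branch_multilinear (m : G -> U -> U -> U) (r : ternary K G) c :
  (forall e, bilinear2 (m e)) ->
  [/\ forall u u' v w, branch m m r c (u + u') v w =
        branch m m r c u v w + branch m m r c u' v w,
      forall u v v' w, branch m m r c u (v + v') w =
        branch m m r c u v w + branch m m r c u v' w
    & forall u v w w', branch m m r c u v (w + w') =
        branch m m r c u v w + branch m m r c u v w'].
Proof.
move=> mbil; split=> *; rewrite -big_split; apply: eq_bigr => i _;
  rewrite -big_split; apply: eq_bigr => j _ /=.
- by rewrite (bilinear2Dl (mbil j)) (bilinear2Dl (mbil i)) scalerDr.
- by rewrite (bilinear2Dr (mbil j)) (bilinear2Dl (mbil i)) scalerDr.
by rewrite (bilinear2Dr (mbil i)) scalerDr.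
Qed.

End Transport.

Section SignedMaps.
Variable K : fieldType.

(** All the comparison maps send generators to generators up to sign. *)
Definition signed_map (G H : gens) (b : G -> H) (e : G -> bool) : hom2 K G H :=
  [ffun t => (-1) ^+ e t.1 * (t.2 == b t.1)%:R].

Definition transpose (G H : gens) (f : hom2 K G H) : hom2 K H G :=
  [ffun t => f (t.2, t.1)].

Lemma signed_map_comp (G H L : gens) (b : G -> H) e (f : hom2 K H L) i j :
  hom2_comp (signed_map b e) f (i, j) = (-1) ^+ e i * f (b i, j).
Proof.
rewrite ffunE /= (bigD1 (b i)) //= big1 => [|k ne].
  by rewrite ffunE /= eqxx mulr1 addr0.
by rewrite ffunE /= (negPf ne) mulr0 mul0r.
Qed.

Lemma comp_signed_map (G H L : gens) (b : G -> H) e (f : hom2 K L G) i j :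
  injective b -> hom2_comp f (signed_map b e) (i, b j) = f (i, j) * (-1) ^+ e j.
Proof.
move=> bI; rewrite ffunE /= (bigD1 j) //= big1 => [|k ne].
  by rewrite ffunE /= eqxx mulr1 addr0.
by rewrite ffunE /= (inj_eq bI) eq_sym (negPf ne) !mulr0.
Qed.

Lemma signed_map_transpose (G H : gens) (b : G -> H) (e : G -> bool) :
  bijective b ->
  hom2_comp (signed_map b e) (transpose (signed_map b e)) = hom2_id K G /\
  hom2_comp (transpose (signed_map b e)) (signed_map b e) = hom2_id K H.
Proof.
move=> [b' bK b'K]; have bI := can_inj bK; split; apply/ffunP=> -[i j].
  rewrite signed_map_comp !ffunE /= (inj_eq bI).
  by case: eqVneq => [->|]; rewrite ?mulr0 // mulr1 -expr2 sqrr_sign.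
rewrite -[j]b'K comp_signed_map // !ffunE /=.
by case: eqVneq; rewrite ?mulr0 ?mul0r // mulr1 -expr2 sqrr_sign.
Qed.

Lemma signed_map_equivariant2 (G H : gens) (b : G -> H) (e : G -> bool) :
  (forall i, b (gswap i) = gswap (b i)) ->
  (forall i, e (gswap i) = e i (+) (gneg i (+) gneg (b i))) ->
  equivariant2 (signed_map b e).
Proof.
move=> bS eS i j; rewrite !ffunE /= bS eS (inj_eq (can_inj (@gswapK H))).
case: eqVneq => [->|]; last by rewrite !mulr0.
by rewrite !mulr1 signr_addb mulrC.
Qed.

Lemma signed_map_signed_map (G H L : gens) (b : G -> H) e (b' : H -> L) e' :
  hom2_comp (signed_map b e) (signed_map b' e') =
  signed_map (fun i => b' (b i)) (fun i => e i (+) e' (b i)).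
Proof.
apply/ffunP=> -[i j]; rewrite signed_map_comp !ffunE /=.
by rewrite signr_addb mulrA.
Qed.

Lemma eq_signed_map (G H : gens) (b b' : G -> H) (e e' : G -> bool) :
  b =1 b' -> e =1 e' -> signed_map b e = signed_map b' e'.
Proof. by move=> bE eE; apply/ffunP=> t; rewrite !ffunE bE eE. Qed.

Lemma signed_map_id (G : gens) : signed_map id (fun=> false) = hom2_id K G.
Proof. by apply/ffunP=> t; rewrite !ffunE mul1r eq_sym. Qed.

Lemma hom3_signed_tree (G H : gens) (b : G -> H) e c i j :
  hom3 (signed_map b e) (tree K c i j) =
  (-1) ^+ (e i (+) e j) *: tree K c (b i) (b j).
Proof.
apply/ffunP=> -[[c' i'] j']; rewrite !ffunE /=.
rewrite (bigD1 i) //= [X in _ + X]big1 ?addr0 => [|k ne]; last first.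
  by rewrite big1 // => l _; rewrite !ffunE !xpair_eqE (negPf ne) andbF !mul0r.
rewrite (bigD1 j) //= big1 ?addr0 => [|l ne]; last first.
  by rewrite !ffunE !xpair_eqE (negPf ne) andbF !mul0r.
rewrite !ffunE /= !xpair_eqE !eqxx !andbT /GRing.scale /= signr_addb.
case: (c' == c); rewrite ?mul0r ?mulr0 // !mul1r mulrACA -natrM mulnb.
by [].
Qed.

Lemma black_mor_signed (G G' H : gens) (b : G -> G') :
  black_mor (signed_map b (fun=> false)) (hom2_id K H) =
  @signed_map (gens_black G H) (gens_black G' H)
    (fun t => (b t.1, t.2)) (fun=> false).
Proof.
apply/ffunP=> -[[i j] [i' j']]; rewrite black_morE !ffunE /= !mul1r.
by rewrite xpair_eqE [j == j']eq_sym -natrM mulnb.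
Qed.

Lemma pull_signed_map (G H : gens) (V : lmodType K) (b : G -> H) e
    (n : H -> V -> V -> V) i x y :
  pull_op (signed_map b e) n i x y = (-1) ^+ e i *: n (b i) x y.
Proof.
rewrite /pull_op (bigD1 (b i)) //= big1 => [|k ne].
  by rewrite ffunE /= eqxx mulr1 addr0.
by rewrite ffunE /= (negPf ne) mulr0 scale0r.
Qed.

Lemma operations_ext (J : finType) (V : lmodType K)
    (n n' : free_gens J -> V -> V -> V) :
  is_operations n -> is_operations n' ->
  (forall g x y, n (g, false) x y = n' (g, false) x y) -> forall g, n g =2 n' g.
Proof.
move=> [_ ns] [_ ns'] nn' [g []] // x y.
by rewrite (ns (g, true)) (ns' (g, true)) nn'.
Qed.

Lemma satisfies_ext (G : gens) (V : lmodType K) (n n' : G -> V -> V -> V) r :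
  (forall g, n g =2 n' g) -> satisfies n r <-> satisfies n' r.
Proof.
move=> nn'; rewrite !satisfiesE; split=> nr x; rewrite -[RHS](nr x);
  by apply: eq_bigr => t _; rewrite !nn'.
Qed.

Lemma satisfies_pull (G H : gens) (V : lmodType K) (f : hom2 K G H)
    (n : H -> V -> V -> V) r :
  is_operations n -> satisfies (pull_op f n) r <-> satisfies n (hom3 f r).
Proof.
move=> [nbil _]; rewrite !satisfiesE.
by split=> nr x; rewrite -[RHS](nr x) eval3_pull.
Qed.

End SignedMaps.

(** * A universal nilpotent algebra *)

Section Model.
Variables (K : fieldType) (G : gens) (w : ternary K G).

(** The degrees 1, 2, 3 of a nilpotent algebra on generators x_0, x_1, x_2 in which
products with a repeated generator vanish: the generators, the products
e_g (x_c, x_(c+1)), and a line on which w evaluates the ternary products. *)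
Definition model : lmodType K :=
  ({ffun 'Z_3 -> K^o} * {ffun 'Z_3 * G -> K^o} * K^o)%type.

Definition model_gen (a : 'Z_3) : model := (dirac a, 0, 0).

Definition model_prod2 (g : G) (x y : {ffun 'Z_3 -> K^o}) :
    {ffun 'Z_3 * G -> K^o} :=
  [ffun t => x t.1 * y (t.1 + 1) * (t.2 == g)%:R
     + (-1) ^+ gneg g * (y t.1 * x (t.1 + 1) * (t.2 == gswap g)%:R)].

Definition model_prod3 (g : G) (p : {ffun 'Z_3 * G -> K^o}) (y : {ffun 'Z_3 -> K^o}) : K :=
  \sum_t p t * y (t.1 + 2) * w (t.1, g, t.2).

Definition model_op (g : G) (u v : model) : model :=
  (0, model_prod2 g u.1.1 v.1.1,
   model_prod3 g u.1.2 v.1.1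
     + (-1) ^+ gneg g * model_prod3 (gswap g) v.1.2 u.1.1).

Lemma model_op_operations : is_operations model_op.
Proof.
have model_sym i x y : model_op i y x = (-1) ^+ gneg i *: model_op (gswap i) x y.
  congr (_, _, _); first by rewrite /= scaler0.
    apply/ffunP=> t; rewrite !ffunE /= gneg_swap gswapK.
    by rewrite /GRing.scale /= mulrDr signrMK addrC.
  rewrite /= gneg_swap gswapK.
  by rewrite /GRing.scale /= mulrDr signrMK addrC.
have model_linear i y : linear (model_op i ^~ y).
  move=> a u v; congr (_, _, _); first by rewrite /= scaler0 addr0.
    by apply/ffunP=> t; rewrite !ffunE /= /GRing.scale /=; ring.
  rewrite /model_prod3 /= /GRing.scale /=.
  have -> : \sum_t (a *: u.1.2 + v.1.2) t * y.1.1 (t.1 + 2) * w (t.1, i, t.2) =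
      a * (\sum_t u.1.2 t * y.1.1 (t.1 + 2) * w (t.1, i, t.2))
      + \sum_t v.1.2 t * y.1.1 (t.1 + 2) * w (t.1, i, t.2).
    rewrite mulr_sumr -big_split; apply: eq_bigr => t _ /=.
    by rewrite !ffunE /= /GRing.scale /=; ring.
  have -> : \sum_t y.1.2 t * (a *: u.1.1 + v.1.1) (t.1 + 2) * w (t.1, gswap i, t.2) =
      a * (\sum_t y.1.2 t * u.1.1 (t.1 + 2) * w (t.1, gswap i, t.2))
      + \sum_t y.1.2 t * v.1.1 (t.1 + 2) * w (t.1, gswap i, t.2).
    rewrite mulr_sumr -big_split; apply: eq_bigr => t _ /=.
    by rewrite !ffunE /= /GRing.scale /=; ring.
  by rewrite /model_prod3; ring.
split=> // i; split=> // x a u v.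
rewrite !(model_sym i _ x) model_linear scalerDr !scalerA.
by rewrite [_ * a]mulrC.
Qed.

Lemma model_op3 i j x y z : model_op i (model_op j x y) z =
  (0, 0, \sum_c (x.1.1 c * y.1.1 (c + 1) * z.1.1 (c + 2) * w (c, i, j)
    + y.1.1 c * x.1.1 (c + 1) * z.1.1 (c + 2) * ((-1) ^+ gneg j * w (c, i, gswap j)))).
Proof.
congr (_, _, _).
  by apply/ffunP=> t; rewrite !ffunE /= ?ffunE !(mul0r, mulr0) addr0.
rewrite /= /model_prod3 /= [X in _ + _ * X]big1 ?mulr0 ?addr0; last first.
  by move=> t _; rewrite ffunE mulr0 mul0r.
transitivity (\sum_c \sum_g
    model_prod2 j x.1.1 y.1.1 (c, g) * z.1.1 (c + 2) * w (c, i, g)).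
  by rewrite pair_bigA; apply: eq_bigr => -[c g].
apply: eq_bigr => c _.
pose P g := x.1.1 c * y.1.1 (c + 1) * z.1.1 (c + 2) * w (c, i, g).
pose P' g := y.1.1 c * x.1.1 (c + 1) * z.1.1 (c + 2) * ((-1) ^+ gneg j * w (c, i, g)).
transitivity (\sum_g ((if g == j then P g else 0) + (if g == gswap j then P' g else 0))).
  apply: eq_bigr => g _; rewrite ffunE /= 2!mulrDl; congr (_ + _).
    by case: ifP => _; rewrite ?mulr1 // mulr0 !mul0r.
  by rewrite /P'; case: ifP => _; rewrite ?mulr1 ?mulr0 ?mul0r //; ring.
by rewrite big_split /= !sum_dirac.
Qed.

Lemma prod_Z3 (F : 'Z_3 -> K) c : \prod_a F a = F c * F (c + 1) * F (c + 2).
Proof. exact: big_Z3. Qed.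

(** A ternary operation sees its arguments through the six ways of distributing the
three generators among them, one for each permutation of the variables. *)
Lemma model_eval3 (x : 'Z_3 -> model) r : eval3 model_op x r =
  (0, 0, \sum_k (\prod_a (x a).1.1 (a + k)) * dot (rotate k r) w
         + \sum_k (\prod_a (x a).1.1 (k + 1 - a)) * dot (mirror k r) w).
Proof.
pose X a c := (x a).1.1 c.
pose P t c := X t.1.1 c * X (t.1.1 + 1) (c + 1) * X (t.1.1 + 2) (c + 2)
  * w (c, t.1.2, t.2).
pose P' t c := X (t.1.1 + 1) c * X t.1.1 (c + 1) * X (t.1.1 + 2) (c + 2)
  * ((-1) ^+ gneg t.2 * w (c, t.1.2, gswap t.2)).
pose L (k : K) : model := (0, 0, k).
have LE (I : finType) (F : I -> K) : \sum_i L (F i) = L (\sum_i F i).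
  by elim/big_rec2: _ => // i u v _ ->; congr (_, _, _); apply: addr0.
transitivity (\sum_t L (r t * \sum_c (P t c + P' t c))).
  apply: eq_bigr => t _; rewrite model_op3.
  by congr (_, _, _); exact: scaler0.
rewrite LE; congr (_, _, _); rewrite /P /P' {P P'}.
under eq_bigr do rewrite big_split mulrDr /=.
rewrite big_split /=; congr (_ + _).
  under [RHS]eq_bigr do rewrite dot_rotate mulr_sumr.
  rewrite [RHS]exchange_big; apply: eq_bigr => -[[c i] j] _ /=.
  rewrite (reindex_inj (addrI c)) mulr_sumr; apply: eq_bigr => k _ /=.
  rewrite (prod_Z3 (fun a => X a (a + k)) c) ffunE /= opprK ![c + _ + k]addrAC.
  by ring.
under [RHS]eq_bigr do rewrite dot_mirror mulr_sumr.
rewrite [RHS]exchange_big; apply: eq_bigr => -[[c i] j] _ /=.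
rewrite (reindex_inj (addIr (- c))) mulr_sumr; apply: eq_bigr => k _ /=.
rewrite (prod_Z3 (fun a => X a (k + 1 - a)) c) ffunE /=.
have -> : k + 1 - (c + 1) = k - c by rewrite opprD addrACA subrr addr0.
have -> : k + 1 - (c + 2) = k - c + 2.
  by rewrite opprD addrACA; congr (_ + _); apply: val_inj.
by rewrite [k + 1 - c]addrAC; ring.
Qed.

Lemma model_satisfies W r : submodule W -> (forall r, W r -> dot r w = 0) ->
  W r -> satisfies model_op r.
Proof.
move=> subW Ww Wr; apply/satisfiesE=> x; rewrite model_eval3.
rewrite !big1 ?addr0 // => k _; rewrite Ww ?mulr0 //.
  exact: submodule_mirror.
exact: submodule_rotate.
Qed.

(** On the three generators in their natural order only the identity permutation
contributes. *)
Lemma model_faithful r : satisfies model_op r -> dot r w = 0.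
Proof.
move=> /satisfiesE /(_ model_gen); rewrite model_eval3 => -[].
rewrite (bigD1 0) //= [X in X + _]addrC big1 ?add0r; last first.
  move=> k nk; rewrite (bigD1 0) //= ffunE add0r.
  by rewrite (negPf nk) !mul0r.
rewrite [X in _ + X]big1 ?addr0 => [|k _].
  rewrite big1 ?mul1r => [<-|a _]; last by rewrite ffunE addr0 eqxx.
  by apply: eq_bigr => -[[c i] j] _; rewrite ffunE /= subr0.
suff [a na] : exists a : 'Z_3, k + 1 - a != a.
  by rewrite (bigD1 a) //= ffunE (negPf na) !mul0r.
have [k0|k0] := eqVneq (k + 1) 0; first by exists 1; rewrite k0.
by exists 0; rewrite subr0.
Qed.

End Model.

Section BlackAlgebras.
Variables (K : fieldType) (Q O : operad K).

(** To be an algebra over the black product of Q and O it suffices to satisfy the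
products of the presenting relations of Q with all the relations of O: the
action of S_3 on a product of relations can be moved to its second factor. *)
Lemma black_algebra (V : lmodType K)
    (n : gens_black (ogen Q) (ogen O) -> V -> V -> V) :
  is_operations n ->
  (forall u s, @orel K Q u -> @orelations K O s -> satisfies n (hadamard u s)) ->
  forall r, @orelations K (black Q O) r -> satisfies n r.
Proof.
move=> nop nQ; have nsub := satisfies_submodule nop.
pose W (u : ternary K (ogen Q)) :=
  forall s, @orelations K O s -> satisfies n (hadamard u s).
have Wsub : submodule W.
  apply: submoduleP.
  - split=> [|a u v Wu Wv] s Rs.
      rewrite (_ : hadamard _ _ = 0); first by case: nsub => -[].
      by apply/ffunP=> t; rewrite !ffunE mul0r.
    by rewrite hadamardDl; case: nsub => -[_ nD] _; apply: nD; auto.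
  - move=> k u Wu s Rs.
    have -> : hadamard (rotate k u) s = rotate k (hadamard u (rotate (- k) s)).
      by rewrite rotate_hadamard -{1}[s](rotateK (- k)) opprK.
    exact: submodule_rotate nsub (Wu _ (orelations_rotate _ Rs)).
  - move=> k u Wu s Rs.
    have -> : hadamard (mirror k u) s = - mirror k (hadamard u (mirror k s)).
      by rewrite mirror_hadamard opprK mirrorK.
    rewrite -scaleN1r; apply: (subspaceZ _ (proj1 nsub)).
    exact: submodule_mirror nsub (Wu _ (orelations_mirror _ Rs)).
apply: (black_min (proj1 nsub)) => u s Ru Rs.
by apply: (tspan_min Wsub _ Ru) => // v Qv s' Rs'; apply: nQ.
Qed.

(** The algebras [model_op w], for w vanishing on the relations, detect everything
that is not a relation. *)
Lemma black_complete phi :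
  (forall (V : lmodType K) (n : gens_black (ogen Q) (ogen O) -> V -> V -> V),
     is_operations n ->
     (forall r, @orelations K (black Q O) r -> satisfies n r) ->
     satisfies n phi) ->
  @orelations K (black Q O) phi.
Proof.
move=> phi_sat; apply/black_relations => w kw.
apply: (@model_faithful _ _ w); apply: phi_sat; first exact: model_op_operations.
move=> r; apply: model_satisfies (orelations_submodule (black Q O)) _ => u.
by move/black_relations; apply.
Qed.

End BlackAlgebras.

(** * Dg algebras on the interval *)

Lemma sigma_linear (K : fieldType) (V : lmodType K) : linear (@sigma K V).
Proof. by move=> a u v; congr (_, _, _); rewrite /= scaler0 addr0. Qed.

Lemma rel_sigma_linear (K : fieldType) (V : lmodType K) : linear (@rel_sigma K V).
Proof. by move=> a u v; congr (_, _); rewrite /= scaler0 addr0. Qed.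

(** There are no cochains above degree 1, so relations are only to be tested on at
most one argument of degree 1, and then Koszul signs play no role. *)
Lemma teval_vanishes (K : fieldType) (O : operad K) (C : complex K)
    (m : ogen O -> C -> C -> C) r :
  (forall i k l x y, cdeg k x -> cdeg l y -> cdeg (k + l) (m i x y)) ->
  (forall k u, @cdeg K C k.+2 u -> u = 0) ->
  (forall x, (forall a, @cdeg K C 0 (x a)) -> eval3 m x r = 0) ->
  (forall (s : 'Z_3) x, @cdeg K C 1 (x s) -> @cdeg K C 0 (x (s + 1)) ->
     @cdeg K C 0 (x (s + 2)) -> eval3 m x r = 0) ->
  forall d x, (forall a, @cdeg K C (d a) (x a)) -> teval m d x r = 0.
Proof.
move=> mdeg C2 r0 r1 d x dx.
pose n := (\sum_a d a)%N.
have nE c : n = (d c + d (c + 1)%R + d (c + 2)%R)%N by rewrite /n (big_Z3 _ _ c).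
clearbody n.
case: (ltnP 1 n) => n1.
  rewrite /teval big1 // => c _; rewrite big1 // => i _; rewrite big1 // => j _.
  rewrite (C2 n.-2 (m i _ _)) ?scaler0 // (_ : n.-2.+2 = n); last by lia.
  by rewrite (nE c); exact: (mdeg _ _ _ _ _ (mdeg _ _ _ _ _ (dx _) (dx _)) (dx _)).
have degE a k : d a = k -> cdeg k (x a) by move<-; apply: dx.
rewrite teval_eval3 => [|c].
  have [ds|ds] := pickP (fun s => d s != 0%N).
    move=> /= ds0; apply: (r1 ds).
    - by apply: degE; have := nE ds; lia.
    - by apply: degE; have := nE ds; lia.
    - by apply: degE; have := nE ds; lia.
  by apply: r0 => a; apply/degE/eqP/negbFE/ds.
have := nE 0; rewrite !add0r /koszul_exp => n0.
by case: eqP => // _; case: eqP => _; rewrite oddM; lia.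
Qed.

Lemma dg_algebra_branches (K : fieldType) (O : operad K) (C : complex K)
    (m : ogen O -> C -> C -> C) r c k0 k1 k2 u v w :
  (forall d x, (forall a, @cdeg K C (d a) (x a)) -> teval m d x r = 0) ->
  (k0 + k1 + k2 <= 1)%N -> cdeg k0 u -> cdeg k1 v -> cdeg k2 w ->
  branch m m r c u v w + branch m m r (c + 1) v w u
    + branch m m r (c + 2) w u v = 0.
Proof.
move=> mr k1le du dv dw.
have [X [X0 X1 X2]] := Z3_point c u v w.
have [d [d0 d1 d2]] := Z3_point c k0 k1 k2.
rewrite -[RHS](mr d X) => [|a].
  rewrite teval_eval3 => [|a]; first by rewrite (eval3_rotation _ _ _ c) X0 X1 X2.
  have dsum b : (\sum_a d a = d b + d (b + 1)%R + d (b + 2)%R)%N.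
    by rewrite (big_Z3 _ _ b).
  have : (d 0%R + d 1%R + d 2%R <= 1)%N.
    by have := dsum 0; rewrite !add0r => <-; rewrite (dsum c) d0 d1 d2.
  by rewrite /koszul_exp => dle; case: eqP => // _; case: eqP => _; rewrite oddM; lia.
have: [|| a == c, a == c + 1 | a == c + 2] by move: {+}a {+}c; do 2!elim/Z3_ind.
by case/or3P=> /eqP->; rewrite ?d0 ?X0 ?d1 ?X1 ?d2 ?X2.
Qed.

Section DgOperations.
Variables (K : fieldType) (O : operad K) (V : lmodType K).
Variables F H : ogen O -> V -> V -> V.

(** The operation at a vertex, as the Leibniz rule forces it; this is the associated
O-algebra structure on V. *)
Definition vertex_op e x y := F e x y + H e x y.

(** H is meant to be the opposite of F up to sign. *)
Definition interval_op e (u v : interval V) : interval V :=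
  (vertex_op e u.1.1 v.1.1, vertex_op e u.1.2 v.1.2,
   F e u.1.1 v.2 + H e u.1.2 v.2 + (H e u.2 v.1.1 + F e u.2 v.1.2)).

Definition rel_op e (u v : rel_interval V) : rel_interval V :=
  (vertex_op e u.1 v.1, H e u.1 v.2 + F e u.2 v.1).

Local Notation iop := interval_op.
Local Notation rop := rel_op.

Hypothesis Fbil : forall e, bilinear2 (F e).
Hypothesis HF : forall e x y, H e x y = (-1) ^+ gneg e *: F (gswap e) y x.

Lemma opposite_bilinear e : bilinear2 (H e).
Proof.
split=> x a u v; rewrite !HF.
  by rewrite (Fbil _).2 scalerDr !scalerA mulrC.
by rewrite (Fbil _).1 scalerDr !scalerA mulrC.
Qed.
Let Hbil := opposite_bilinear.

Lemma opposite_opK e x y : F e x y = (-1) ^+ gneg e *: H (gswap e) y x.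
Proof. by rewrite HF gswapK gneg_swap scalerA -expr2 sqrr_sign scale1r. Qed.

Lemma vertex_op_bilinear e : bilinear2 (vertex_op e).
Proof.
split=> x a u v; rewrite /vertex_op.
  by rewrite (Fbil e).1 (Hbil e).1 scalerDr addrACA.
by rewrite (Fbil e).2 (Hbil e).2 scalerDr addrACA.
Qed.

Lemma vertex_opC e x y : vertex_op e y x = (-1) ^+ gneg e *: vertex_op (gswap e) x y.
Proof. by rewrite /vertex_op (opposite_opK e) (HF e) -scalerDr addrC. Qed.

Let vertex_bil := vertex_op_bilinear.

Lemma ideg1 (u : interval V) : ideg 1 u -> u.1.1 = 0 /\ u.1.2 = 0.
Proof. by move=> /= ->. Qed.

Lemma ideg_zero k : ideg k (0 : interval V).
Proof. by case: k => [|[]]. Qed.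

Lemma interval_op_bilinear e : bilinear2 (iop e).
Proof.
split=> x a u v; congr (_, _, _) => /=; rewrite ?(vertex_bil e).1 ?(vertex_bil e).2 //.
  by rewrite !(Fbil e).1 !(Hbil e).1 !scalerDr [RHS]addrACA; congr (_ + _); apply: addrACA.
by rewrite !(Fbil e).2 !(Hbil e).2 !scalerDr [RHS]addrACA; congr (_ + _); apply: addrACA.
Qed.

Lemma rel_op_bilinear e : bilinear2 (rop e).
Proof.
split=> x a u v; congr (_, _) => /=; rewrite ?(vertex_bil e).1 ?(vertex_bil e).2 //.
  by rewrite !(Fbil e).1 !(Hbil e).1 addrACA !scalerDr.
by rewrite !(Fbil e).2 !(Hbil e).2 addrACA !scalerDr.
Qed.

Lemma interval_op_deg e k l (x y : interval V) :
  ideg k x -> ideg l y -> ideg (k + l) (iop e x y).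
Proof.
have iop0 z : iop e 0 z = 0 := bilinear20l (interval_op_bilinear e) z.
have iop0r z : iop e z 0 = 0 := bilinear20r (interval_op_bilinear e) z.
case: k => [|[|k]] dx; case: l => [|[|l]] dy;
  try by [rewrite dx iop0; apply: ideg_zero|rewrite dy iop0r; apply: ideg_zero].
- rewrite /= in dx dy *; rewrite dx dy (bilinear20r (Fbil e)) (bilinear20r (Hbil e)).
  by rewrite (bilinear20l (Fbil e)) (bilinear20l (Hbil e)) !addr0.
- have [y1 y2] := ideg1 dy.
  by rewrite /= y1 y2 !(bilinear20r (vertex_bil e)).
- have [x1 x2] := ideg1 dx.
  by rewrite /= x1 x2 !(bilinear20l (vertex_bil e)).
have [x1 x2] := ideg1 dx; have [y1 y2] := ideg1 dy.
rewrite /= /interval_op x1 x2 y1 y2 !(bilinear20l (vertex_bil e)) (bilinear20r (Fbil e)).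
by rewrite (bilinear20r (Hbil e)) (bilinear20l (Fbil e)) (bilinear20l (Hbil e)) !addr0.
Qed.

Lemma rel_op_deg e k l (x y : rel_interval V) :
  rel_deg k x -> rel_deg l y -> rel_deg (k + l) (rop e x y).
Proof.
have rel0 d : rel_deg d (0 : rel_interval V) by case: d => [|[]].
have rop0 z : rop e 0 z = 0 := bilinear20l (rel_op_bilinear e) z.
have rop0r z : rop e z 0 = 0 := bilinear20r (rel_op_bilinear e) z.
case: k => [|[|k]] dx; case: l => [|[|l]] dy;
  try by [rewrite dx rop0; apply: rel0|rewrite dy rop0r; apply: rel0].
- rewrite /= in dx dy *; rewrite dx dy (bilinear20r (Hbil e)).
  by rewrite (bilinear20l (Fbil e)) addr0.
- by rewrite /= in dy *; rewrite dy (bilinear20r (vertex_bil e)).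
- by rewrite /= in dx *; rewrite dx (bilinear20l (vertex_bil e)).
rewrite /= in dx dy *; rewrite /rel_op dx dy (bilinear20l (vertex_bil e)).
by rewrite (bilinear20r (Fbil e)) (bilinear20l (Hbil e)) addr0.
Qed.

Lemma interval_op_diff e k (x y : interval V) : ideg k x ->
  idiff (iop e x y) = iop e (idiff x) y + (-1) ^+ k *: iop e x (idiff y).
Proof.
case: k => [|[|k]] dx.
- rewrite expr0 scale1r /=; congr (_, _, _) => /=;
    rewrite ?(bilinear20l (vertex_bil e)) ?(bilinear20r (vertex_bil e)) ?addr0 //.
  rewrite !(bilinear20l (Fbil e)) !(bilinear20l (Hbil e)) !add0r.
  rewrite /= in dx; rewrite dx (bilinear20l (Fbil e)) (bilinear20l (Hbil e)) !addr0.
  rewrite !(bilinear2Dl (Fbil e), bilinear2Dl (Hbil e)).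
  rewrite !(bilinear2Dr (Fbil e), bilinear2Dr (Hbil e)).
  rewrite !(bilinear2Nl (Fbil e), bilinear2Nl (Hbil e)).
  rewrite !(bilinear2Nr (Fbil e), bilinear2Nr (Hbil e)) opprD /vertex_op.
  (* the terms that mix the two vertices cancel *)
  by rewrite [RHS](AC ((2*2)*(2*2)) ((3*7)*(6*2)*((1*8)*(5*4)))) /= !subrr !addr0.
- have [x1 x2] := ideg1 dx.
  have -> : idiff x = 0 by rewrite /idiff x1 x2 subrr.
  rewrite (bilinear20l (interval_op_bilinear e)) add0r; congr (_, _, _) => /=;
    rewrite ?x1 ?x2 ?(bilinear20l (vertex_bil e)) ?(bilinear20l (Fbil e)) ?(bilinear20l (Hbil e));
    by rewrite ?(bilinear20r (Fbil e)) ?(bilinear20r (Hbil e)) ?subrr ?addr0 ?scaler0.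
have idiff0 : idiff 0 = 0 :> interval V by rewrite /idiff subrr.
by rewrite dx idiff0 !(bilinear20l (interval_op_bilinear e)) idiff0 scaler0 addr0.
Qed.

Lemma rel_op_diff e k (x y : rel_interval V) : rel_deg k x ->
  rel_diff (rop e x y) = rop e (rel_diff x) y + (-1) ^+ k *: rop e x (rel_diff y).
Proof.
case: k => [|[|k]] dx.
- rewrite expr0 scale1r /=; congr (_, _) => /=;
    rewrite ?(bilinear20l (vertex_bil e)) ?(bilinear20r (vertex_bil e)) ?addr0 //.
  rewrite /= in dx; rewrite dx (bilinear20l (Fbil e)) (bilinear20l (Hbil e)) !addr0 add0r.
  by [].
- rewrite /= in dx; have -> : rel_diff x = 0 by rewrite /rel_diff dx.
  rewrite (bilinear20l (rel_op_bilinear e)) add0r; congr (_, _) => /=;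
    rewrite dx ?(bilinear20l (vertex_bil e)) ?(bilinear20l (Fbil e)) ?(bilinear20l (Hbil e));
    by rewrite ?(bilinear20r (Fbil e)) ?(bilinear20r (Hbil e)) ?addr0 ?scaler0.
have rel_diff0 : rel_diff 0 = 0 :> rel_interval V by [].
by rewrite dx rel_diff0 !(bilinear20l (rel_op_bilinear e)) scaler0 addr0.
Qed.

Lemma interval_op_sym e k l (x y : interval V) : ideg k x -> ideg l y ->
  iop e y x = (-1) ^+ (k * l + gneg e) *: iop (gswap e) x y.
Proof.
move=> dx dy.
have symE : iop e y x = (-1) ^+ gneg e *: iop (gswap e) x y.
  congr (_, _, _) => /=; rewrite 1?vertex_opC //.
  by rewrite !scalerDr -!HF -!opposite_opK addrC.
rewrite exprD -scalerA -symE -signr_odd oddM.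
case: (boolP (odd k && odd l)) => [/andP[ok ol]|_]; last by rewrite scale1r.
suff -> : iop e y x = 0 by rewrite scaler0.
have := @interval_op_deg e l k _ _ dy dx.
by case: k l ok ol {dx dy} => [|k] [|l] //= _ _; rewrite addnS.
Qed.

Lemma rel_op_sym e k l (x y : rel_interval V) : rel_deg k x -> rel_deg l y ->
  rop e y x = (-1) ^+ (k * l + gneg e) *: rop (gswap e) x y.
Proof.
move=> dx dy.
have symE : rop e y x = (-1) ^+ gneg e *: rop (gswap e) x y.
  congr (_, _) => /=; rewrite 1?vertex_opC //.
  by rewrite !scalerDr -!HF -!opposite_opK addrC.
rewrite exprD -scalerA -symE -signr_odd oddM.
case: (boolP (odd k && odd l)) => [/andP[ok ol]|_]; last by rewrite scale1r.
suff -> : rop e y x = 0 by rewrite scaler0.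
have := @rel_op_deg e l k _ _ dy dx.
by case: k l ok ol {dx dy} => [|k] [|l] //= _ _; rewrite addnS.
Qed.

Lemma rel_opE e (x y : V) :
  ((rop e (rel_sigma x) (rel_rho y) = rel_sigma (F e x y))
  * (rop e (rel_rho x) (rel_sigma y) = rel_sigma (H e x y)))%type.
Proof.
split; congr (_, _) => /=.
- exact: bilinear20l.
- by rewrite (bilinear20l (Hbil e)) add0r.
- exact: bilinear20r.
by rewrite (bilinear20l (Fbil e)) addr0.
Qed.

Let F0l e := bilinear20l (Fbil e).
Let F0r e := bilinear20r (Fbil e).
Let H0l e := bilinear20l (Hbil e).
Let H0r e := bilinear20r (Hbil e).
Let vop0l e := bilinear20l (vertex_bil e).
Let vop0r e := bilinear20r (vertex_bil e).

(** The relation r on (sigma x, rho y, rho z) when sigma stands at leaf c; the two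
terms with c + 1 come from the vertex operation F + H applied to y, z. *)
Definition prelie_identity (r : ternary K (ogen O)) :=
  forall c x y z, branch F F r c x y z + branch H F r (c + 1) y z x
    + (branch F H r (c + 2) z x y + branch H H r (c + 1) y z x) = 0.

(** The relation r on (lambda x, sigma y, rho z) and on (sigma x, lambda y, rho z),
that is, its products with the associators of even and of odd permutations. *)
Definition assoc_identity (r : ternary K (ogen O)) :=
  (forall c x y z, branch F F r c x y z + branch H F r (c + 1) y z x = 0) /\
  (forall c x y z, branch F H r c x y z + branch H H r (c + 2) z x y = 0).

(** Associators that vanish are symmetric. *)
Lemma assoc_prelie r : assoc_identity r -> prelie_identity r.
Proof.
move=> [rA rB] c x y z; rewrite rA add0r.
by have := rB (c + 2) z x y; have [_ _ _ ->] := Z3_succ c.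
Qed.

(** The commutator of a pre-Lie product is a Lie bracket, with coefficients: the sum
over the three cyclic positions of the pre-Lie identity contains each of the
twelve branches of r for F + H exactly once. *)
Lemma eval3_vertex_op r x : prelie_identity r -> eval3 vertex_op x r = 0.
Proof.
move=> rP; rewrite eval3_branch.
transitivity (\sum_c (branch F F r c (x c) (x (c + 1)) (x (c + 2))
   + branch F H r c (x c) (x (c + 1)) (x (c + 2))
   + (branch H F r c (x c) (x (c + 1)) (x (c + 2))
   + branch H H r c (x c) (x (c + 1)) (x (c + 2))))).
  by apply: eq_bigr => c _; rewrite /vertex_op branchDl !branchDr.
rewrite !big_split /=.
rewrite [X in _ + X + _](reindex_inj (addIr 2)) /=.
rewrite [X in _ + (X + _)](reindex_inj (addIr 1)) /=.
rewrite [X in _ + (_ + X)](reindex_inj (addIr 1)) /=.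
rewrite addrACA -!big_split big1 // => c _ /=.
by have [-> -> -> ->] := Z3_succ c; apply: rP.
Qed.

Lemma rel_op_relation r d (x : 'Z_3 -> rel_interval V) : prelie_identity r ->
  (forall a, rel_deg (d a) (x a)) -> teval rop d x r = 0.
Proof.
move=> rP; apply: (@teval_vanishes K O (rel_interval V)) => {d x}.
- exact: rel_op_deg.
- by [].
- move=> x dx; have x2 a : (x a).2 = 0 := dx a.
  rewrite [LHS]surjective_pairing.
  rewrite (@eval3_linear _ _ _ _ fst rop vertex_op) // eval3_vertex_op //.
  rewrite (linear_map_sum (p := snd)) // big1 // => t _ /=.
  by rewrite !x2 !(F0l, F0r, H0l, H0r, addr0) scaler0.
move=> s x dz dy1 dy2.
have -> : eval3 rop x r = rel_sigma (
    branch F F r s (x s).2 (x (s + 1)).1 (x (s + 2)).1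
    + branch H vertex_op r (s + 1) (x (s + 1)).1 (x (s + 2)).1 (x s).2
    + branch F H r (s + 2) (x (s + 2)).1 (x s).2 (x (s + 1)).1).
  have slin := @rel_sigma_linear K V.
  rewrite (eval3_rotation _ _ _ s) !(linear_mapD slin).
  congr (_ + _ + _); apply: branch_linear => // i j; congr (_, _) => /=;
    rewrite /= in dz dy1 dy2; rewrite ?dz ?dy1 ?dy2;
    by rewrite ?(F0l, F0r, H0l, H0r, vop0l, vop0r, addr0, add0r).
rewrite /vertex_op branchDr // (AC (1*2*1) ((1*2)*(4*3))) /= rP //.
Qed.

Lemma interval_opE e (x y : V) :
  ((iop e (sigma x) (lambda y) = sigma (H e x y))
  * (iop e (sigma x) (rho y) = sigma (F e x y))
  * (iop e (lambda x) (sigma y) = sigma (F e x y))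
  * (iop e (rho x) (sigma y) = sigma (H e x y))
  * (iop e (lambda x) (lambda y) = lambda (vertex_op e x y))
  * (iop e (rho x) (rho y) = rho (vertex_op e x y))
  * (iop e (lambda x) (rho y) = 0) * (iop e (rho x) (lambda y) = 0))%type.
Proof.
by do !split; congr (_, _, _) => /=;
  rewrite ?(F0l, F0r, H0l, H0r, vop0l, vop0r, addr0, add0r).
Qed.

(** On one sigma and two vertices each argument at a vertex splits as lambda + rho.
The mixed terms are associativity; the terms (lambda, lambda) and (rho, rho) are
sums of two associativity identities. *)
Lemma interval_op_relation r d (x : 'Z_3 -> interval V) : assoc_identity r ->
  (forall a, ideg (d a) (x a)) -> teval iop d x r = 0.
Proof.
move=> rA; have rP := assoc_prelie rA.
apply: (@teval_vanishes K O (interval V)) => {d x}.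
- exact: interval_op_deg.
- by [].
- move=> x dx; have x2 a : (x a).2 = 0 := dx a.
  rewrite [LHS]surjective_pairing [(eval3 _ _ _).1]surjective_pairing.
  have -> : (eval3 iop x r).1.1 = 0.
    rewrite -(@eval3_vertex_op r (fun a => (x a).1.1) rP).
    exact: (@eval3_linear _ _ _ _ (fun u : interval V => u.1.1)).
  have -> : (eval3 iop x r).1.2 = 0.
    rewrite -(@eval3_vertex_op r (fun a => (x a).1.2) rP).
    exact: (@eval3_linear _ _ _ _ (fun u : interval V => u.1.2)).
  rewrite (linear_map_sum (p := snd)) // big1 // => t _ /=.
  by rewrite !x2 !(F0l, F0r, H0l, H0r, addr0) scaler0.
move=> s x dz dy1 dy2.
have slin := @sigma_linear K V.
have b0 c u v w : (forall i j, iop i (iop j u v) w = 0) -> branch iop iop r c u v w = 0.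
  by move=> m0; apply: big1 => i _; apply: big1 => j _; rewrite m0 scaler0.
have iop0l e v : iop e 0 v = 0 := bilinear20l (interval_op_bilinear e) v.
have lrE u : @cdeg K (interval V) 0 u -> u = lambda u.1.1 + rho u.1.2.
  by case: u => [[u1 u2] u3] /= ->; congr (_, _, _); rewrite /= ?addr0 ?add0r.
rewrite (eval3_rotation _ _ _ s) (lrE _ dy1) (lrE _ dy2).
have -> : x s = sigma (x s).2 by rewrite [LHS]surjective_pairing [(x s).1]dz.
move: (x s).2 (x (s + 1)).1.1 (x (s + 1)).1.2 (x (s + 2)).1.1 (x (s + 2)).1.2.
move=> z x1 y1 x2 y2 {x dz dy1 dy2}.
(* the evaluation with sigma z at position s, additive in the other arguments *)
pose T u v := branch iop iop r s (sigma z) u v + branch iop iop r (s + 1) u v (sigma z)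
  + branch iop iop r (s + 2) v (sigma z) u.
have bD := branch_multilinear r _ interval_op_bilinear.
have TDl u u' v : T (u + u') v = T u v + T u' v.
  have [[[_ D2 _] [D1 _ _]] [_ _ D3]] := (bD s, bD (s + 1), bD (s + 2)).
  by rewrite /T D1 D2 D3 (AC (2*2*2) ((1*3*5)*(2*4*6))).
have TDr u v v' : T u (v + v') = T u v + T u v'.
  have [[[_ _ D3] [_ D2 _]] [D1 _ _]] := (bD s, bD (s + 1), bD (s + 2)).
  by rewrite /T D1 D2 D3 (AC (2*2*2) ((1*3*5)*(2*4*6))).
rewrite -[LHS]/(T _ _) TDl !TDr /T {T TDl TDr bD}.
have bE c u v w F' H' x' y' z' :
  (forall i j, iop i (iop j u v) w = sigma (F' i (H' j x' y') z')) ->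
  branch iop iop r c u v w = sigma (branch F' H' r c x' y' z').
  exact: branch_linear.
have [rA1 rA2] := rA; have [s11 s12 s21 s22] := Z3_succ s.
have ll : branch iop iop r s (sigma z) (lambda x1) (lambda x2) +
    branch iop iop r (s + 1) (lambda x1) (lambda x2) (sigma z) +
    branch iop iop r (s + 2) (lambda x2) (sigma z) (lambda x1) = 0.
  rewrite (bE _ _ _ _ H H z x1 x2) => [|i j]; last by rewrite !interval_opE.
  rewrite (bE _ _ _ _ F vertex_op x1 x2 z) => [|i j]; last by rewrite !interval_opE.
  rewrite (bE _ _ _ _ H F x2 z x1) => [|i j]; last by rewrite !interval_opE.
  rewrite -!(linear_mapD slin) branchDr // (AC (1*2*1) ((2*4)*(3*1))) /=.
  have := rA1 (s + 1) x1 x2 z; have := rA2 (s + 1) x1 x2 z.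
  by rewrite s11 s12 => -> ->; rewrite addr0.
have lr : branch iop iop r s (sigma z) (lambda x1) (rho y2) +
    branch iop iop r (s + 1) (lambda x1) (rho y2) (sigma z) +
    branch iop iop r (s + 2) (rho y2) (sigma z) (lambda x1) = 0.
  rewrite (bE _ _ _ _ F H z x1 y2) => [|i j]; last by rewrite !interval_opE.
  rewrite (b0 (s + 1)) => [|i j]; last by rewrite interval_opE iop0l.
  rewrite (bE _ _ _ _ H H y2 z x1) => [|i j]; last by rewrite !interval_opE.
  by rewrite addr0 -!(linear_mapD slin) rA2.
have rl : branch iop iop r s (sigma z) (rho y1) (lambda x2) +
    branch iop iop r (s + 1) (rho y1) (lambda x2) (sigma z) +
    branch iop iop r (s + 2) (lambda x2) (sigma z) (rho y1) = 0.
  rewrite (bE _ _ _ _ H F z y1 x2) => [|i j]; last by rewrite !interval_opE.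
  rewrite (b0 (s + 1)) => [|i j]; last by rewrite interval_opE iop0l.
  rewrite (bE _ _ _ _ F F x2 z y1) => [|i j]; last by rewrite !interval_opE.
  rewrite addr0 -!(linear_mapD slin) addrC.
  by have := rA1 (s + 2) x2 z y1; rewrite s21 => ->.
have rr : branch iop iop r s (sigma z) (rho y1) (rho y2) +
    branch iop iop r (s + 1) (rho y1) (rho y2) (sigma z) +
    branch iop iop r (s + 2) (rho y2) (sigma z) (rho y1) = 0.
  rewrite (bE _ _ _ _ F F z y1 y2) => [|i j]; last by rewrite !interval_opE.
  rewrite (bE _ _ _ _ H vertex_op y1 y2 z) => [|i j]; last by rewrite !interval_opE.
  rewrite (bE _ _ _ _ F H y2 z y1) => [|i j]; last by rewrite !interval_opE.
  by rewrite -!(linear_mapD slin) branchDr // (AC (1*2*1) ((1*2)*(4*3))) /= rP.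
by rewrite ll lr rl rr !addr0.
Qed.

End DgOperations.

(** * Associators and the algebras over their black products *)

Section Associators.
Variables (K : fieldType) (G : gens) (m : G).

(** The associator of x_c, x_(c+1), x_(c+2) for the operation m, in the basis of
trees: x (y z) is the opposite of m at the root of the tree of y, z. *)
Definition assoc_rel (c : 'Z_3) : ternary K G :=
  (-1) *: tree K (c + 1) (gswap m) m + tree K c m m.

(** The associator of x_(c+1), x_c, x_(c+2), for the remaining odd permutations. *)
Definition assoc_rel_op (c : 'Z_3) : ternary K G :=
  (-1) *: tree K (c + 2) (gswap m) (gswap m) + tree K c m (gswap m).

Lemma rotate_assoc_rel k c : rotate k (assoc_rel c) = assoc_rel (c + k).
Proof. by rewrite rotateD !rotate_tree addrAC. Qed.

Lemma rotate_assoc_rel_op k c : rotate k (assoc_rel_op c) = assoc_rel_op (c + k).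
Proof. by rewrite rotateD !rotate_tree addrAC. Qed.

Lemma rotate_right_symmetric_associator k :
  rotate k ((-1) *: assoc_rel_op (0 + 2) + assoc_rel 0) =
  (-1) *: assoc_rel_op (k + 2) + assoc_rel k.
Proof.
by rewrite rotateD rotate_assoc_rel rotate_assoc_rel_op !add0r [2 + k]addrC.
Qed.

Hypothesis m_pos : gneg m = false.

Lemma associator_even :
  lmon K 0 1 2 m m - rmon K 0 1 2 m m = assoc_rel 0.
Proof.
have lE a b c (i j : G) : b = a + 1 -> lmon K a b c i j = tree K a i j.
  by move=> ->; apply: lmonE.
rewrite /rmon m_pos !lE; try by apply: val_inj.
by rewrite expr0 scale1r /assoc_rel scaleN1r addrC add0r.
Qed.

Lemma associator_odd :
  lmon K 0 2 1 m m - rmon K 0 2 1 m m = assoc_rel_op 2.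
Proof.
have lE a b c (i j : G) : a = b + 1 ->
    lmon K a b c i j = (-1) ^+ gneg j *: tree K b i (gswap j).
  by move=> ->; apply: lmonNE.
rewrite /rmon !lE; try by apply: val_inj.
have s22 : 2 + 2 = 1 :> 'Z_3 by apply: val_inj.
by rewrite m_pos expr0 !scale1r /assoc_rel_op scaleN1r [RHS]addrC s22.
Qed.

(** The right pre-Lie relation. *)
Lemma right_symmetric_associator :
  (lmon K 0 1 2 m m - rmon K 0 1 2 m m) - (lmon K 0 2 1 m m - rmon K 0 2 1 m m)
  = (-1) *: assoc_rel_op (0 + 2) + assoc_rel 0.
Proof.
by rewrite associator_even associator_odd [0 + 2 in RHS]add0r scaleN1r [RHS]addrC.
Qed.

(** The two families of associators form one S_3-orbit. *)
Lemma mirror_assoc_rel k c : mirror k (assoc_rel c) = assoc_rel_op (k - c).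
Proof.
have m1 : - 1 = 2 :> 'Z_3 by apply: val_inj.
by rewrite mirrorD !mirror_tree m_pos expr0 !scale1r opprD m1 addrA.
Qed.

End Associators.

Lemma hom3_assoc_rel (K : fieldType) (G H : gens) (b : G -> H) m c :
  b (gswap m) = gswap (b m) ->
  hom3 (signed_map K b (fun=> false)) (assoc_rel K m c) = assoc_rel K (b m) c.
Proof.
by move=> bm; rewrite hom3D !hom3_signed_tree !expr0 !scale1r bm.
Qed.

Definition ass_op (b : bool) : pgens 1 0 0 := nsym ord0 b.

Lemma Ass_assoc_rel K c : @orelations K (Ass K) (@assoc_rel K _ (ass_op false) c).
Proof.
rewrite -[c]add0r -rotate_assoc_rel; apply: orelations_rotate; apply: tspan_gen.
exact: (esym (associator_even K _)).
Qed.

Lemma Ass_assoc_rel_op K c : @orelations K (Ass K) (@assoc_rel_op K _ (ass_op false) c).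
Proof.
rewrite -[c]subr0 -mirror_assoc_rel //; apply: orelations_mirror; apply: tspan_gen.
exact: (esym (associator_even K _)).
Qed.

Lemma preLie_rel K c : @orelations K (preLie K)
  ((-1) *: @assoc_rel_op K _ (ass_op false) (c + 2) + @assoc_rel K _ (ass_op false) c).
Proof.
rewrite -(rotate_right_symmetric_associator K (ass_op false) c).
apply: orelations_rotate; apply: tspan_gen.
exact: (esym (right_symmetric_associator K _)).
Qed.

Section BlackEvaluation.
Variables (K : fieldType) (Q : gens) (O : operad K) (V : lmodType K) (m : Q).
Variable n : gens_black Q (ogen O) -> V -> V -> V.
Variables F H : ogen O -> V -> V -> V.
Hypothesis nF : forall e x y, n (m, e) x y = F e x y.
Hypothesis nH : forall e x y, n (gswap m, e) x y = - H e x y.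
Hypothesis nbil : forall e, bilinear2 (n e).

(** Here n interprets e times the product by F_e and e times the opposite product by
- H_e.  The sign of H turns the difference in the associator into a sum. *)
Lemma eval3_assoc_rel X c s :
  eval3 n X (hadamard (assoc_rel K m c) s) =
  branch F F s c (X c) (X (c + 1)) (X (c + 2))
  + branch H F s (c + 1) (X (c + 1)) (X (c + 2)) (X c).
Proof.
rewrite hadamardDl eval3D !eval3_hadamard_tree addrC.
have [-> -> _ _] := Z3_succ c; congr (_ + _).
  by do 2![apply: eq_bigr => ? _]; rewrite !nF.
rewrite scaleN1r -sumrN; apply: eq_bigr => i _; rewrite -sumrN.
by apply: eq_bigr => j _; rewrite nH nF scalerN opprK.
Qed.

Lemma eval3_assoc_rel_op X c s :
  eval3 n X (hadamard (assoc_rel_op K m c) s) =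
  - (branch F H s c (X c) (X (c + 1)) (X (c + 2))
  + branch H H s (c + 2) (X (c + 2)) (X c) (X (c + 1))).
Proof.
rewrite hadamardDl eval3D !eval3_hadamard_tree addrC opprD.
have [_ _ -> ->] := Z3_succ c; congr (_ + _).
  rewrite -sumrN; apply: eq_bigr => i _; rewrite -sumrN; apply: eq_bigr => j _.
  by rewrite nH (bilinear2Nl (nbil _)) nF scalerN.
rewrite scaleN1r; congr (- _).
apply: eq_bigr => i _; apply: eq_bigr => j _.
by rewrite [n (_, j) _ _]nH (bilinear2Nl (nbil _)) nH opprK.
Qed.

Lemma assoc_identity_of_black s :
  (forall c, satisfies n (hadamard (assoc_rel K m c) s)) ->
  (forall c, satisfies n (hadamard (assoc_rel_op K m c) s)) ->
  assoc_identity F H s.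
Proof.
move=> sA sB; split=> c x y z; have [X [<- <- <-]] := Z3_point c x y z.
  by rewrite -eval3_assoc_rel; have /satisfiesE := sA c; apply.
by apply: oppr_inj; rewrite -eval3_assoc_rel_op oppr0; have /satisfiesE := sB c; apply.
Qed.

Lemma eval3_prelie_rel X c s :
  eval3 n X (hadamard ((-1) *: assoc_rel_op K m (c + 2) + assoc_rel K m c) s) =
  branch F F s c (X c) (X (c + 1)) (X (c + 2))
  + branch H F s (c + 1) (X (c + 1)) (X (c + 2)) (X c)
  + (branch F H s (c + 2) (X (c + 2)) (X c) (X (c + 1))
     + branch H H s (c + 1) (X (c + 1)) (X (c + 2)) (X c)).
Proof.
rewrite hadamardDl eval3D scaleN1r eval3_assoc_rel_op eval3_assoc_rel opprK addrC.
by have [_ _ -> ->] := Z3_succ c.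
Qed.

Lemma prelie_identity_of_black s :
  (forall c, satisfies n (hadamard
     ((-1) *: assoc_rel_op K m (c + 2) + assoc_rel K m c) s)) ->
  prelie_identity F H s.
Proof.
move=> sP c x y z; have [X [<- <- <-]] := Z3_point c x y z.
by rewrite -eval3_prelie_rel; have /satisfiesE := sP c; apply.
Qed.

End BlackEvaluation.

(** * Black products with the associative and the pre-Lie operads *)

Section AssBlack.
Variable K : fieldType.

Definition is_opposite (q : pgens 1 0 0) : bool :=
  if q is inl (inl (_, b)) then b else false.

Lemma is_oppositeK : cancel is_opposite ass_op.
Proof. by case=> [[[i b]|[]//]|[]//]; rewrite /ass_op /nsym /= (ord1 i). Qed.

Definition aop_inv p q r (e : pidx p q r) : aidx p q r :=
  match e with
  | inl (inl (i, b)) => inl (inl (if b then inr i else inl i))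
  | inl (inr j) => inl (inr j)
  | inr k => inr k
  end.

Lemma aopK p q r : cancel (@aop p q r) (@aop_inv p q r).
Proof. by case=> [[[i|i]|j]|k]. Qed.

Lemma aop_invK p q r : cancel (@aop_inv p q r) (@aop p q r).
Proof. by case=> [[[i []]|j]|k]. Qed.

(** Generators of a black product have for opposite, up to sign, the pair of the
opposites of both factors. *)
Definition swap_if (G : gens) (b : bool) (e : G) : G := if b then gswap e else e.

Lemma swap_ifK (G : gens) b : involutive (@swap_if G b).
Proof. by case: b => // e; apply: gswapK. Qed.

(** The operation g of Ass_bullet O corresponds to the product tensored with the
operation [aop g] of O. *)
Definition ass_gen p q r (g : agens p q r) : gens_black (pgens 1 0 0) (pgens p q r) :=
  (ass_op g.2, @swap_if (pgens p q r) g.2 (aop g.1)).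

(** On opposites there is an additional sign, since the transposition acts on the
generators of a black product with a twist by sgn. *)
Definition ass_sign p q r (g : agens p q r) : bool :=
  aneg g.1 (+) (g.2 && ~~ pneg (aop g.1)).

Definition ass_black p q r := @signed_map K _ _ (@ass_gen p q r) (@ass_sign p q r).

Lemma ass_gen_bij p q r : bijective (@ass_gen p q r).
Proof.
exists (fun t => (aop_inv (@swap_if (pgens p q r) (is_opposite t.1) t.2), is_opposite t.1)).
  by case=> g b; rewrite /ass_gen /= swap_ifK aopK.
by case=> m e; rewrite /ass_gen /= aop_invK swap_ifK is_oppositeK.
Qed.

Lemma ass_black_equivariant2 p q r : equivariant2 (ass_black p q r).
Proof.
apply: signed_map_equivariant2 => -[g b].
  rewrite /ass_gen /=; congr (_, _).
  by case: b => //=; rewrite pswapK.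
rewrite /ass_sign /= /tens_neg /=.
have -> : pneg (swap_if b (aop g)) = pneg (aop g) by case: b => //=; apply: pneg_swap.
by case: b; case: aneg; case: pneg.
Qed.

Lemma ass_black_natural (O P : presented K)
    (f : hom2 K (presented_gens O) (presented_gens P)) : equivariant2 f ->
  hom2_comp (ass_black _ _ _) (black_mor (hom2_id K (pgens 1 0 0)) f) =
  hom2_comp (Ass_bullet_mor f) (ass_black _ _ _).
Proof.
move=> fE; apply/ffunP=> -[g t].
have [inv invK genK] := ass_gen_bij (nbr_nsym P) (nbr_symm P) (nbr_anti P).
rewrite -[t]genK; case: (inv t) => h b' {t}; case: g => g b.
rewrite comp_signed_map; last exact: can_inj invK.
rewrite signed_map_comp black_morE [hom2_id _ _ _]ffunE [Ass_bullet_mor _ _]ffunE /=.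
have -> : (ass_op b == ass_op b') = (b == b') by apply/eqP/eqP => [[]|->].
case: eqVneq => [<-|_]; last by rewrite !mul0r mulr0.
rewrite !mul1r /ass_sign /=; case: b => /=; last first.
  by rewrite !addbF signr_addb -mulrA mulrCA -mulrA mulrCA -expr2 sqrr_sign mulr1 mulrC.
have -> : f (pswap (aop g), pswap (aop h)) = _ := fE (aop g) (aop h).
by rewrite /=; case: (aneg g); case: (aneg h); case: (pneg (aop g)); case: (pneg (aop h));
  rewrite /= ?expr0 ?expr1 !(mulN1r, mul1r, mulr1, mulrN1, opprK).
Qed.

End AssBlack.

Section BlackOf.
Variables (K : fieldType) (O : operad K) (V : lmodType K).
Variables F H : ogen O -> V -> V -> V.

(** With this sign the tensor product with the associator evaluates to a relation
on cochains, see [eval3_assoc_rel]. *)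
Definition black_op (t : gens_black (pgens 1 0 0) (ogen O)) (x y : V) : V :=
  if is_opposite t.1 then - H t.2 x y else F t.2 x y.

Lemma black_op_operations : (forall e, bilinear2 (F e)) ->
  (forall e x y, H e x y = (-1) ^+ gneg e *: F (gswap e) y x) ->
  is_operations black_op.
Proof.
move=> Fbil HF; have Hbil := opposite_bilinear Fbil HF.
split=> [[q e]|[q e] x y]; rewrite /black_op /= -[q]is_oppositeK.
  case: (is_opposite q) => /=; last exact: Fbil.
  split=> x a u v.
    by rewrite (Hbil e).1 opprD scalerN.
  by rewrite (Hbil e).2 opprD scalerN.
have signN (b : bool) (v : V) : - ((-1) ^+ b *: v) = (-1) ^+ (~~ b) *: v.
  by case: b; rewrite ?scaleN1r ?scale1r ?opprK.
case: (is_opposite q) => /=; rewrite /tens_neg /= negbK.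
  by rewrite HF; apply: signN.
by rewrite scalerN (opposite_opK HF) -[LHS]opprK; congr (- _); apply: signN.
Qed.

End BlackOf.

Section Relations.
Variables (K : fieldType) (O : presented K).

Lemma pull_ass_black (V : lmodType K)
    (n : gens_black (pgens 1 0 0) (presented_gens O) -> V -> V -> V) g x y :
  pull_op (ass_black K _ _ _) n (g, false) x y =
  (-1) ^+ aneg g *: n (ass_op false, aop g) x y.
Proof. by rewrite pull_signed_map /ass_sign addbF. Qed.

Section Split.
Variables (V : lmodType K).
Variable n : gens_black (pgens 1 0 0) (presented_gens O) -> V -> V -> V.
Hypothesis nop : is_operations n.

(** Conversely, F and H are recovered from operations n of the black product. *)
Definition left_part (e : ogen O) (x y : V) : V := n (ass_op false, e) x y.
Definition right_part (e : ogen O) (x y : V) : V := - n (ass_op true, e) x y.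

Lemma left_part_bilinear e : bilinear2 (left_part e).
Proof. exact: nop.1. Qed.

Lemma right_partE e x y :
  right_part e x y = (-1) ^+ gneg e *: left_part (gswap e) y x.
Proof.
rewrite /left_part (nop.2 (ass_op false, gswap e)) /= /tens_swap /tens_neg /=.
rewrite pswapK negbK pneg_swap.
rewrite scalerA /right_part.
by case: (pneg e); rewrite ?expr0 ?expr1 ?mulN1r ?mul1r scaleN1r.
Qed.

(** The operations on cochains built from [left_part] and [right_part] are encoded
by the operations that n induces on V. *)
Lemma ass_black_encodes :
  [/\ forall i x y, left_part (nsym i false) x y =
        pull_op (ass_black K _ _ _) n (prec i) x y,
      forall i x y, right_part (nsym i false) y x =
        - pull_op (ass_black K _ _ _) n (succ i) x y,
      forall j x y, left_part (symm j) x y =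
        pull_op (ass_black K _ _ _) n (circ j) x y
    & forall k x y, left_part (anti k) x y =
        pull_op (ass_black K _ _ _) n (ast k) x y].
Proof.
split=> *; rewrite pull_ass_black /= ?expr0 ?scale1r //.
by rewrite right_partE expr1 scaleN1r opprK expr0 scale1r.
Qed.

End Split.

(** Each algebra over the black product gives a local dg algebra, in which relations
of Ass_bullet O must hold. *)
Lemma Ass_bullet_complete rel :
  @orel K (Ass_bullet O) rel ->
  @orelations K (black (Ass K) O) (hom3 (ass_black K _ _ _) rel).
Proof.
move=> rel_sat.
apply: black_complete => V n nop nsat.
have Fbil := left_part_bilinear nop; have HF := right_partE nop.
have rA r : @orelations K O r ->
    @assoc_identity K O V (left_part n) (right_part n) r.
  move=> Rr; apply: (@assoc_identity_of_black _ _ _ _ (ass_op false) n) => //.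
  - by move=> e x y; rewrite /right_part opprK.
  - exact: nop.1.
  - by move=> c; exact: (nsat _ (black_hadamard (@Ass_assoc_rel K c) Rr)).
  - by move=> c; exact: (nsat _ (black_hadamard (@Ass_assoc_rel_op K c) Rr)).
apply/(satisfies_pull _ _ nop).
apply: (rel_sat V (@interval_op K O V (left_part n) (right_part n))).
- have tot0l e := bilinear20l (vertex_op_bilinear Fbil HF e).
  have tot0r e := bilinear20r (vertex_op_bilinear Fbil HF e).
  split; [split| | |].
  + exact: interval_op_bilinear.
  + exact: interval_op_deg.
  + exact: interval_op_diff.
  + exact: interval_op_sym.
  + by move=> r Rr d x dx; apply: interval_op_relation => //; apply: rA.
  + split=> //; rewrite /vanish_l.
    * by move=> a x y /= -> ->; rewrite scaler0 addr0.
    * by move=> e x y /= ->; rewrite tot0l tot0r.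
  + split=> //; rewrite /vanish_r.
    * by move=> a x y /= -> ->; rewrite scaler0 addr0.
    * by move=> e x y /= ->; rewrite tot0l tot0r.
  + split=> //; rewrite /vanish_lr /vanish_l /vanish_r.
    * by move=> a x y /= [-> ->] [-> ->]; rewrite scaler0 addr0.
    * by move=> e x y /= [-> ->]; rewrite !tot0l !tot0r.
- exact: pull_operations (@ass_black_equivariant2 K _ _ _) nop.
- have [precE succE circE astE] := ass_black_encodes nop.
  have sN (v : V) : sigma (- v) = - sigma v by congr (_, _, _); rewrite /= oppr0.
  split=> [i x y|j x y|k x y]; rewrite !(interval_opE Fbil HF).
  + by rewrite precE succE sN.
  + by rewrite circE.
  + by rewrite astE.
Qed.

(** Locality and the Leibniz rule express all products of cochains by F and H; then
a relation of O on (lambda, sigma, rho) is its product with the associator. *)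
Lemma Ass_bullet_sound rel :
  @orelations K (black (Ass K) O) (hom3 (ass_black K _ _ _) rel) ->
  @orel K (Ass_bullet O) rel.
Proof.
move=> rel_black V m n mloc nop nenc.
have [[mbil mdeg mdiff msym mrel] [_ _ _ ml] [_ _ _ mr] _] := mloc.
pose F (e : ogen O) x y := (m e (lambda x) (sigma y)).2.
pose H (e : ogen O) x y := (m e (sigma x) (lambda y)).2.
(* the product lies in both ideals, and in degree 0 *)
have lam_rho e x y : m e (lambda x) (rho y) = 0.
  rewrite [LHS]surjective_pairing [(m _ _ _).1]surjective_pairing.
  have -> : (m e (lambda x) (rho y)).1.1 = 0 := (ml e (rho y) (lambda x) erefl).2.
  have -> : (m e (lambda x) (rho y)).1.2 = 0 := (mr e (lambda x) (rho y) erefl).1.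
  by have -> : (m e (lambda x) (rho y)).2 = 0 := mdeg e 0 0 (lambda x) (rho y) erefl erefl.
have rho_lam e x y : m e (rho x) (lambda y) = 0.
  by rewrite (msym e 0 0) // lam_rho scaler0.
have lam_sig e x y : m e (lambda x) (sigma y) = sigma (F e x y).
  rewrite [LHS]surjective_pairing.
  by have -> : (m e (lambda x) (sigma y)).1 = 0 := mdeg e 0 1 (lambda x) (sigma y) erefl erefl.
have sig_lam e x y : m e (sigma x) (lambda y) = sigma (H e x y).
  rewrite [LHS]surjective_pairing.
  by have -> : (m e (sigma x) (lambda y)).1 = 0 := mdeg e 1 0 (sigma x) (lambda y) erefl erefl.
have slin := @sigma_linear K V.
have sN (v : V) : sigma (- v) = - sigma v by congr (_, _, _); rewrite /= oppr0.
(* differentiate lambda x times rho y *)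
have sig_rho e x y : m e (sigma x) (rho y) = sigma (F e x y).
  have := mdiff e 0%N (lambda x) (rho y) erefl.
  rewrite lam_rho expr0 scale1r /= /idiff /= subr0 sub0r subr0.
  rewrite -/(sigma (- x)) -/(sigma y) sN (bilinear2Nl (mbil e)) lam_sig => /eqP.
  by rewrite eq_sym addrC subr_eq0 => /eqP.
have HF e x y : H e x y = (-1) ^+ gneg e *: F (gswap e) y x.
  by rewrite /H (msym e 0%N 1%N) //.
have Fbil e : bilinear2 (F e).
  split=> x a u v; rewrite /F.
    by rewrite slin (mbil e).1.
  have -> : lambda (a *: u + v) = a *: lambda u + lambda v :> interval V.
    by congr (_, _, _); rewrite /= ?scaler0 ?addr0.
  by rewrite (mbil e).2.
pose N := @black_op K O V F H.
have Nop : is_operations N := black_op_operations Fbil HF.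
have Nsat : satisfies N (hom3 (ass_black K _ _ _) rel).
  apply: (@black_algebra K (Ass K) O V N Nop _ _ rel_black) => u s Qu Rs.
  have -> : u = assoc_rel K (ass_op false) 0.
    exact: (etrans Qu (associator_even K _)).
  apply/satisfiesE => X.
  rewrite (@eval3_assoc_rel K _ O V (ass_op false) N F H) //.
  move: (X 0) (X (0 + 1)) (X (0 + 2)) => x y z.
  have := dg_algebra_branches 0 (mrel s Rs) (isT : 0 + 1 + 0 <= 1)%N
    (erefl : cdeg 0%N (lambda x : interval V)) (erefl : cdeg 1%N (sigma y : interval V))
    (erefl : cdeg 0%N (rho z : interval V)).
  have -> : branch m m s 0 (lambda x) (sigma y) (rho z) = sigma (branch F F s 0 x y z).
    by apply: (branch_linear _ _ slin) => i j; rewrite lam_sig sig_rho.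
  have -> : branch m m s (0 + 1) (sigma y) (rho z) (lambda x) =
      sigma (branch H F s (0 + 1) y z x).
    by apply: (branch_linear _ _ slin) => i j; rewrite sig_rho sig_lam.
  have -> : branch m m s (0 + 2) (rho z) (lambda x) (sigma y) = 0.
    by apply: big1 => i _; apply: big1 => j _; rewrite rho_lam (bilinear20l (mbil i)) scaler0.
  by rewrite addr0 -(linear_mapD slin) => -[].
apply/satisfies_ext/(satisfies_pull _ _ Nop); last exact: Nsat.
apply: operations_ext nop (pull_operations (@ass_black_equivariant2 K _ _ _) Nop) _.
have [nE1 nE2 nE3] := nenc.
move=> [[[i|i]|j]|k] x y; rewrite pull_ass_black /N /black_op /= ?expr0 ?scale1r.
- have [E _ _ _] := nE1 i x y; move: E.
  by rewrite lam_sig => -[].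
- have [_ _ _ E] := nE1 i y x; move: E.
  rewrite sig_lam (opposite_opK HF) expr1 /= expr0 scale1r scaleN1r -sN => -[->].
  by rewrite opprK.
- have [E _] := nE2 j x y; move: E.
  by rewrite lam_sig => -[].
have [E _] := nE3 k x y; move: E.
by rewrite lam_sig => -[].
Qed.

(** As for Ass_bullet, with cochains that vanish at the left vertex. *)
Lemma preLie_bullet_complete rel :
  @orel K (preLie_bullet O) rel ->
  @orelations K (black (preLie K) O) (hom3 (ass_black K _ _ _) rel).
Proof.
move=> rel_sat.
apply: black_complete => V n nop nsat.
have Fbil := left_part_bilinear nop; have HF := right_partE nop.
apply/(satisfies_pull _ _ nop).
apply: (rel_sat V (@rel_op K O V (left_part n) (right_part n))).
- split.
  + exact: rel_op_bilinear.
  + exact: rel_op_deg.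
  + exact: rel_op_diff.
  + exact: rel_op_sym.
  + move=> r Rr d x dx; apply: rel_op_relation => //.
    apply: (@prelie_identity_of_black _ _ _ _ (ass_op false) n) => //.
    * by move=> e y z; rewrite /right_part opprK.
    * exact: nop.1.
    * by move=> c; exact: (nsat _ (black_hadamard (@preLie_rel K c) Rr)).
- exact: pull_operations (@ass_black_equivariant2 K _ _ _) nop.
- have [precE succE circE astE] := ass_black_encodes nop.
  have sN (v : V) : rel_sigma (- v) = - rel_sigma v by congr (_, _); rewrite /= oppr0.
  split=> [i x y|j x y|k x y]; rewrite !(rel_opE Fbil HF).
  + by rewrite precE succE sN.
  + by rewrite circE.
  + by rewrite astE.
Qed.

(** A relation of O on (sigma, rho, rho) is its product with the right pre-Lie
relation. *)
Lemma preLie_bullet_sound rel :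
  @orelations K (black (preLie K) O) (hom3 (ass_black K _ _ _) rel) ->
  @orel K (preLie_bullet O) rel.
Proof.
move=> rel_black V m n [mbil mdeg mdiff msym mrel] nop nenc.
pose F (e : ogen O) x y := (m e (rel_sigma x) (rel_rho y)).2.
pose H (e : ogen O) x y := (m e (rel_rho x) (rel_sigma y)).2.
have sig_rho e x y : m e (rel_sigma x) (rel_rho y) = rel_sigma (F e x y).
  rewrite [LHS]surjective_pairing.
  by have -> : (m e (rel_sigma x) (rel_rho y)).1 = 0 :=
    mdeg e 1 0 (rel_sigma x) (rel_rho y) erefl erefl.
have rho_sig e x y : m e (rel_rho x) (rel_sigma y) = rel_sigma (H e x y).
  rewrite [LHS]surjective_pairing.
  by have -> : (m e (rel_rho x) (rel_sigma y)).1 = 0 :=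
    mdeg e 0 1 (rel_rho x) (rel_sigma y) erefl erefl.
have slin := @rel_sigma_linear K V.
have sN (v : V) : rel_sigma (- v) = - rel_sigma v by congr (_, _); rewrite /= oppr0.
(* the second component of the Leibniz rule is the value of d (rho x times rho y) *)
have rho_rho e x y : m e (rel_rho x) (rel_rho y) = rel_rho (vertex_op F H e x y).
  rewrite [LHS]surjective_pairing; congr (_, _); last first.
    exact: (mdeg e 0%N 0%N (rel_rho x) (rel_rho y) erefl erefl).
  have := congr1 snd (mdiff e 0%N (rel_rho x) (rel_rho y) erefl).
  by rewrite expr0 scale1r sig_rho rho_sig.
have HF e x y : H e x y = (-1) ^+ gneg e *: F (gswap e) y x.
  by rewrite /H (msym e 1%N 0%N).
have Fbil e : bilinear2 (F e).
  split=> x a u v; rewrite /F.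
    have -> : rel_rho (a *: u + v) = a *: rel_rho u + rel_rho v :> rel_interval V.
      by congr (_, _); rewrite /= ?scaler0 ?addr0.
    by rewrite (mbil e).1.
  by rewrite slin (mbil e).2.
pose N := @black_op K O V F H.
have Nop : is_operations N := black_op_operations Fbil HF.
have Nsat : satisfies N (hom3 (ass_black K _ _ _) rel).
  apply: (@black_algebra K (preLie K) O V N Nop _ _ rel_black) => u s Qu Rs.
  have -> : u = (-1) *: assoc_rel_op K (ass_op false) (0 + 2) + assoc_rel K (ass_op false) 0.
    exact: (etrans Qu (right_symmetric_associator K _)).
  apply/satisfiesE => X.
  rewrite (@eval3_prelie_rel K _ O V (ass_op false) N F H) //; last exact: Nop.1.
  move: (X 0) (X (0 + 1)) (X (0 + 2)) => x y z.
  have := dg_algebra_branches 0 (mrel s Rs) (isT : 1 + 0 + 0 <= 1)%N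
    (erefl : cdeg 1%N (rel_sigma x : rel_interval V))
    (erefl : cdeg 0%N (rel_rho y : rel_interval V))
    (erefl : cdeg 0%N (rel_rho z : rel_interval V)).
  have -> : branch m m s 0 (rel_sigma x) (rel_rho y) (rel_rho z) =
      rel_sigma (branch F F s 0 x y z).
    by apply: (branch_linear _ _ slin) => i j; rewrite !sig_rho.
  have -> : branch m m s (0 + 1) (rel_rho y) (rel_rho z) (rel_sigma x) =
      rel_sigma (branch H (vertex_op F H) s (0 + 1) y z x).
    by apply: (branch_linear _ _ slin) => i j; rewrite rho_rho rho_sig.
  have -> : branch m m s (0 + 2) (rel_rho z) (rel_sigma x) (rel_rho y) =
      rel_sigma (branch F H s (0 + 2) z x y).
    by apply: (branch_linear _ _ slin) => i j; rewrite rho_sig sig_rho.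
  rewrite -!(linear_mapD slin) /vertex_op branchDr; last exact: opposite_bilinear Fbil HF.
  by rewrite (AC (1*2*1) ((1*2)*(4*3))) => -[].
apply/satisfies_ext/(satisfies_pull _ _ Nop); last exact: Nsat.
apply: operations_ext nop (pull_operations (@ass_black_equivariant2 K _ _ _) Nop) _.
have [nE1 nE2 nE3] := nenc.
move=> [[[i|i]|j]|k] x y; rewrite pull_ass_black /N /black_op /= ?expr0 ?scale1r.
- have [E _] := nE1 i x y; move: E.
  by rewrite sig_rho => -[].
- have [_ E] := nE1 i y x; move: E.
  rewrite rho_sig (opposite_opK HF) expr1 /= expr0 scale1r scaleN1r -sN => -[->].
  by rewrite opprK.
- by move: (nE2 j x y); rewrite sig_rho => -[].
by move: (nE3 k x y); rewrite sig_rho => -[].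
Qed.

End Relations.

(** * Black products with the commutative operad *)

Section AssPreLie.
Variable K : fieldType.

Lemma ass_black_iso_Ass (O : presented K) :
  @is_iso K (Ass_bullet O) (black_left (Ass K) O) (ass_black K _ _ _).
Proof.
have [fg gf] := signed_map_transpose K (@ass_sign _ _ _)
  (ass_gen_bij (nbr_nsym O) (nbr_symm O) (nbr_anti O)).
apply: (@is_iso_of_relations K (Ass_bullet O) (black (Ass K) O) _ _ _ fg gf).
  exact: ass_black_equivariant2.
by split; [apply: Ass_bullet_complete|apply: Ass_bullet_sound].
Qed.

Lemma ass_black_iso_preLie (O : presented K) :
  @is_iso K (preLie_bullet O) (black_left (preLie K) O) (ass_black K _ _ _).
Proof.
have [fg gf] := signed_map_transpose K (@ass_sign _ _ _)
  (ass_gen_bij (nbr_nsym O) (nbr_symm O) (nbr_anti O)).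
apply: (@is_iso_of_relations K (preLie_bullet O) (black (preLie K) O) _ _ _ fg gf).
  exact: ass_black_equivariant2.
by split; [apply: preLie_bullet_complete|apply: preLie_bullet_sound].
Qed.

End AssPreLie.

Section ComBlack.
Variable K : fieldType.

Definition com_op : pgens 0 1 0 := symm ord0.

Lemma com_opE (q : pgens 0 1 0) : q = com_op.
Proof. by case: q => [[[[]//]|j]|[]//]; rewrite /com_op /symm (ord1 j). Qed.

Definition ass_com : hom2 K (pgens 1 0 0) (pgens 0 1 0) :=
  signed_map K (fun=> com_op) (fun=> false).

Lemma ass_com_equivariant2 : equivariant2 ass_com.
Proof. by apply: signed_map_equivariant2 => -[[[i b]|[]//]|[]//]. Qed.

Lemma hom3_ass_com_assoc_rel c :
  hom3 ass_com (assoc_rel K (ass_op false) c) = assoc_rel K com_op c.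
Proof.
exact: (@hom3_assoc_rel K (pgens 1 0 0) (pgens 0 1 0) (fun=> com_op) _ c erefl).
Qed.

Lemma Com_generator : @orel K (Com K) (assoc_rel K com_op 0).
Proof. exact: (esym (associator_even K _)). Qed.

Lemma ass_com_is_mor : @is_mor K (Ass K) (Com K) ass_com.
Proof.
apply: is_mor_gen; first exact: ass_com_equivariant2.
move=> r Rr; have -> : r = assoc_rel K (ass_op false) 0.
  exact: (etrans Rr (associator_even K _)).
by rewrite hom3_ass_com_assoc_rel; apply: tspan_gen; exact: Com_generator.
Qed.

(** The generating relation of Com is the image of that of Ass. *)
Lemma ass_com_onto (r : ternary K (ogen (Com K))) : @orelations K (Com K) r ->
  exists2 r', @orelations K (Ass K) r' & r = hom3 ass_com r'.
Proof.
move: r; apply: (tspan_min (submodule_image ass_com_equivariant2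
  (orelations_submodule (Ass K)))).
move=> r Rr; exists (assoc_rel K (ass_op false) 0); first exact: Ass_assoc_rel.
exact: (etrans Rr (etrans (associator_even K _) (esym (hom3_ass_com_assoc_rel 0)))).
Qed.

Definition com_proj_gen p q r (g : agens p q r) : cgens p q r :=
  match g with
  | (inl (inl (inl i)), b) => nsym i b
  | (inl (inl (inr i)), b) => nsym i (~~ b)
  | (inl (inr j), b) => anti j
  | (inr k, b) => symm k
  end.

Definition com_proj_sign p q r (g : agens p q r) : bool :=
  if g is (inl (inr j), b) then b else false.

Lemma com_projE p q r :
  com_proj K p q r = signed_map K (@com_proj_gen p q r) (@com_proj_sign p q r).
Proof. by apply/ffunP=> -[[[[[i|i]|j]|k] b] h]; rewrite !ffunE /= ?mul1r. Qed.

Definition com_gen p q r (h : cgens p q r) : gens_black (pgens 0 1 0) (pgens p q r) :=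
  (com_op, match h with
           | inl (inl (i, b)) => nsym i b
           | inl (inr k) => anti k
           | inr j => symm j
           end).

Definition com_sign p q r (h : cgens p q r) : bool :=
  if h is inl (inl (i, b)) then b else false.

Definition com_black p q r := signed_map K (@com_gen p q r) (@com_sign p q r).

Lemma com_gen_bij p q r : bijective (@com_gen p q r).
Proof.
exists (fun t => match t.2 with
           | inl (inl (i, b)) => nsym i b
           | inl (inr j) => anti j
           | inr k => symm k
           end).
  by case=> [[[i b]|k]|j].
by case=> m [[[i b]|j]|k]; rewrite (com_opE m).
Qed.

Lemma com_black_equivariant2 p q r : equivariant2 (com_black p q r).
Proof.
apply: signed_map_equivariant2; first by case=> [[[i b]|k]|j].
by case=> [[[i []]|k]|j].
Qed.

(** Identifying generators with those of black products, [com_proj] is the map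
induced by the projection of Ass onto Com. *)
Lemma com_proj_black p q r :
  hom2_comp (com_proj K p q r) (com_black p q r) =
  hom2_comp (ass_black K p q r) (black_mor ass_com (hom2_id K _)).
Proof.
rewrite com_projE black_mor_signed !signed_map_signed_map; apply: eq_signed_map.
  by case=> [[[[i|i]|j]|k] []].
by case=> [[[[i|i]|j]|k] []].
Qed.

Definition com_lift_mor p q r : hom2 K (cgens p q r) (agens p q r) :=
  signed_map K (@com_lift p q r) (fun=> false).

Lemma com_liftK p q r :
  hom2_comp (com_lift_mor p q r) (com_proj K p q r) = hom2_id K (cgens p q r).
Proof.
rewrite com_projE signed_map_signed_map -signed_map_id; apply: eq_signed_map;
  by case=> [[[i b]|k]|j].
Qed.

(** [com_lift] is a section of [com_proj], so that the map on quotients is the one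
induced by [Ass_bullet_mor]. *)
Lemma Com_bullet_morE (O P : presented K)
    (f : hom2 K (presented_gens O) (presented_gens P)) :
  Com_bullet_mor f =
  hom2_comp (com_lift_mor _ _ _) (hom2_comp (Ass_bullet_mor f) (com_proj K _ _ _)).
Proof. by apply/ffunP=> -[h h']; rewrite signed_map_comp mul1r !ffunE. Qed.

(** Since all relations of Com lift to relations of Ass, all relations of the black
product with Com lift to the black product with Ass, hence to Ass_bullet O. *)
Lemma Com_bullet_relations (O : presented K) rel :
  @orel K (Com_bullet O) rel <->
  @orelations K (black (Com K) O) (hom3 (com_black _ _ _) rel).
Proof.
have [phi_mor [psi [psi_mor phiK psiK]]] := ass_black_iso_Ass O.
have pi_mor := black_mor_is_mor ass_com_is_mor (is_mor_id O).
split=> [[rel' Rrel' ->]|Rrel].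
  rewrite -hom3_comp com_proj_black hom3_comp.
  by apply: pi_mor.2; apply: phi_mor.2.
have [v Rv vE] : exists2 v, @orelations K (black (Ass K) O) v &
    hom3 (com_black _ _ _) rel = hom3 (black_mor ass_com (hom2_id K _)) v.
  have subW := submodule_image pi_mor.1 (orelations_submodule (black (Ass K) O)).
  apply: (@black_min K (Com K) O _ (proj1 subW) _ _ Rrel) => r s /ass_com_onto[r' Rr' ->] Rs.
  by exists (hadamard r' s); [apply: black_hadamard|rewrite hom3_hadamard hom3_id].
exists (hom3 psi v); first exact: psi_mor.2.
have [cK _] := signed_map_transpose K (@com_sign _ _ _)
  (com_gen_bij (nbr_nsym O) (nbr_symm O) (nbr_anti O)).
rewrite -[LHS]hom3_id -[RHS]hom3_id -cK !hom3_comp vE; congr (hom3 _ _).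
rewrite -[RHS]hom3_comp com_proj_black [RHS]hom3_comp; congr (hom3 _ _).
by rewrite -hom3_comp [hom2_comp psi _]psiK hom3_id.
Qed.

Lemma com_black_iso (O : presented K) :
  @is_iso K (Com_bullet O) (black_left (Com K) O) (com_black _ _ _).
Proof.
have [fg gf] := signed_map_transpose K (@com_sign _ _ _)
  (com_gen_bij (nbr_nsym O) (nbr_symm O) (nbr_anti O)).
apply: (@is_iso_of_relations K (Com_bullet O) (black (Com K) O) _ _ _ fg gf).
  exact: com_black_equivariant2.
exact: Com_bullet_relations.
Qed.

Lemma com_black_natural (O P : presented K)
    (f : hom2 K (presented_gens O) (presented_gens P)) : equivariant2 f ->
  hom2_comp (com_black _ _ _) (black_mor (hom2_id K (pgens 0 1 0)) f) =
  hom2_comp (Com_bullet_mor f) (com_black _ _ _).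
Proof.
move=> fE; rewrite Com_bullet_morE -!hom2_compA com_proj_black.
rewrite [hom2_comp (Ass_bullet_mor f) _]hom2_compA -ass_black_natural //.
rewrite -hom2_compA black_mor_comp hom2_comp1f hom2_compf1.
rewrite -{1}(hom2_comp1f (com_black _ _ _)) -com_liftK -!hom2_compA; congr (hom2_comp _ _).
rewrite [hom2_comp (com_proj _ _ _ _) _]hom2_compA com_proj_black -hom2_compA.
congr (hom2_comp _ _).
by rewrite black_mor_comp hom2_comp1f hom2_compf1.
Qed.

End ComBlack.

Theorem theorem1p11 (K : fieldType) :
  [/\ naturally_isomorphic (@Ass_bullet K) (@Ass_bullet_mor K)
        (@black_left K (Ass K)) (@black_left_mor K (Ass K)),
      naturally_isomorphic (@Com_bullet K) (@Com_bullet_mor K)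
        (@black_left K (Com K)) (@black_left_mor K (Com K))
    & naturally_isomorphic (@preLie_bullet K) (@preLie_bullet_mor K)
        (@black_left K (preLie K)) (@black_left_mor K (preLie K))].
Proof.
split; apply: naturally_isomorphic_transport (black_left_functor _) _ _.
- exact: ass_black_iso_Ass.
- by move=> O P f [fE _]; apply: ass_black_natural.
- exact: com_black_iso.
- by move=> O P f [fE _]; apply: com_black_natural.
- exact: ass_black_iso_preLie.
- by move=> O P f [fE _]; apply: ass_black_natural.
Qed.
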